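(* Let $G\in L^\infty$, $G\neq 0$, let $N\ge 1$ be an integer with $\dim\ker T_G>N$, and let $B=B_{\lambda_1}B_{\lambda_2}\cdots B_{\lambda_N}$ with $\lambda_j\in\mathbb D$ for $j=1,\dots,N$. Let $F^M=IO$ be the inner-outer factorisation ($I$ inner, $O\in H^2$ outer) of a maximal function $F^M$ in $\ker T_G$, with $\dim K_I\ge N$. Define $I_0=I$, $O_0=O$ and, for $1\le n\le N$, $$I_n=\frac{\tilde k^{I_{n-1}}_{\lambda_n}}{k^{I_{n-1}}_{\lambda_n}},\qquad O_n=k^{I_{n-1}}_{\lambda_n}\,(1-\overline{\lambda_n}z)\,O_{n-1}.$$ Then $F^M_B=B\,I_N\,O_N$ is also a maximal function in $\ker T_G$, and $f^M_B=I_NO_N$ is a maximal function in $\ker T_{GB}$.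
   Context: $\mathbb D$ is the open unit disk, $\mathbb T$ the unit circle, $L^2=L^2(\mathbb T)$, $L^\infty=L^\infty(\mathbb T)$; $H^2=H^2(\mathbb D)$ is identified with a closed subspace of $L^2$ via boundary values, and $P^+:L^2\to H^2$ is the orthogonal projection. For $g\in L^\infty$ the Toeplitz operator $T_g:H^2\to H^2$ is $T_gf=P^+(gf)$. Symbols are assumed nonzero. For $\theta$ inner, the model space is $K_\theta=\ker T_{\overline\theta}=H^2\ominus\theta H^2$. A maximal function in a nontrivial kernel $\ker T_g$ is a nonzero $f^M\in\ker T_g$ such that for every $h\in L^\infty$, $f^M\in\ker T_h$ implies $\ker T_g\subset\ker T_h$. For $\lambda\in\mathbb D$, $B_\lambda(z)=\frac{z-\lambda}{1-\overline\lambda z}$. For an inner function $\theta$ and $\lambda\in\mathbb D$, $$\tilde k^\theta_\lambda=\frac{\theta-\theta(\lambda)}{z-\lambda},\qquad k^\theta_\lambda=\frac{1-\overline{\theta(\lambda)}\,\theta}{1-\overline\lambda z};$$ when $\theta$ is non-constant, $\tilde k^\theta_\lambda/k^\theta_\lambda$ is an inner function. *)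

(* Defs.v *)
From HB Require Import structures.
From mathcomp Require Import all_boot all_order all_algebra.
From mathcomp Require Import all_classical all_reals all_analysis.
From mathcomp Require Import complex.

Set Implicit Arguments.
Unset Strict Implicit.
Unset Printing Implicit Defensive.

Import Order.TTheory GRing.Theory Num.Theory.
Import numFieldNormedType.Exports.

Local Open Scope classical_set_scope.
Local Open Scope ring_scope.
Local Open Scope complex_scope.

(* The complex numbers, packed so that MathComp-Analysis' norm topology of a
   numerical field is found on them. *)
Definition Cx (R : realType) : numClosedFieldType := R[i].

Section Hardy.
Variable R : realType.
Local Notation C := (Cx R).
Local Notation Re := (@complex.Re R).
Local Notation Im := (@complex.Im R).
Implicit Types (f g h p u theta : C -> C) (z lam : C) (t r : R).

Definition disc : set C := [set z | `|z| < 1].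

(* The modulus, as a real number: `|z| itself has type C. *)
Definition cabs z : R := ComplexField.Normc.normc z.

Definition expi t : C := cos t +i* sin t.

Definition cexp z : C := (expR (Re z))%:C * expi (Im z).

(* The unit circle is parametrised by t |-> expi t on [0, 2 pi]; functions on
   the circle are given by functions C -> C, of which only the values at the
   points expi t matter, and these only up to a null set of t. *)
Definition circ : set R := `[0, 2 * pi].

Definition aeT (P : C -> Prop) : Prop :=
  {ae lebesgue_measure, forall t, circ t -> P (expi t)}.

Definition measurableT f : Prop :=
  measurable_fun circ (fun t => Re (f (expi t))) /\
  measurable_fun circ (fun t => Im (f (expi t))).

Definition L2T f : Prop :=
  measurableT f /\
  (\int[lebesgue_measure]_(t in circ) ((cabs (f (expi t)) ^+ 2)%:E) < +oo)%E.

Definition LinfT f : Prop :=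
  measurableT f /\ exists M : R, aeT (fun z => cabs (f z) <= M).

(* integral of a complex function over [0, 2 pi], divided by 2 pi *)
Definition cmean (F : R -> C) : C :=
  ((2 * pi)^-1 * \int[lebesgue_measure]_(t in circ) Re (F t)) +i*
  ((2 * pi)^-1 * \int[lebesgue_measure]_(t in circ) Im (F t)).

Definition dotT f g : C := cmean (fun t => f (expi t) * (g (expi t))^*).

(* holomorphy on the disc, as convergence of the Taylor series at 0 *)
Definition analytic_disc f : Prop :=
  exists a : nat -> C,
    forall z, disc z -> series (fun n => a n * z ^+ n) @ \oo --> f z.

(* An element of H^2 is identified with its boundary function by representing
   it as one function on the closed disc: analytic with bounded quadratic means
   inside, and equal a.e. on the circle to its radial limits.  By Fatou's
   theorem every element of H^2(D) has such an extension, unique up to a null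
   set of the circle. *)
Definition H2 f : Prop :=
  [/\ analytic_disc f,
      exists M : R, forall r, 0 <= r < 1 ->
        (\int[lebesgue_measure]_(t in circ)
           ((cabs (f (r%:C * expi t)) ^+ 2)%:E) <= M%:E)%E,
      L2T f
    & aeT (fun z => (fun r : R => f (r%:C * z)) @ 1^'- --> f z)].

Definition Hinf f : Prop :=
  H2 f /\ exists M : R, forall z, disc z -> cabs (f z) <= M.

(* p = P^+ f, the orthogonal projection of L^2 onto H^2.  It is a relation
   because P^+ f is determined only as an element of H^2, that is on the open
   disc and almost everywhere on the circle. *)
Definition is_proj_H2 f p : Prop :=
  H2 p /\ forall u, H2 u -> dotT (fun z => f z - p z) u = 0.

(* h = T_g f, for f in H^2 *)
Definition is_toeplitz g f h : Prop := is_proj_H2 (fun z => g z * f z) h.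

Definition ker_toeplitz g : set (C -> C) :=
  [set f | H2 f /\ is_toeplitz g f (fun=> 0)].

Definition inner theta : Prop :=
  Hinf theta /\ aeT (fun z => `|theta z| = 1).

Definition outer f : Prop :=
  H2 f /\
  exists (c : C) (phi : R -> R),
    [/\ `|c| = 1,
        forall t, 0 < phi t,
        lebesgue_measure.-integrable circ (fun t => (ln (phi t))%:E)
      & forall z, disc z ->
          f z = c * cexp (cmean (fun t =>
            (expi t + z) / (expi t - z) * (ln (phi t))%:C))].

Definition model_space theta : set (C -> C) :=
  ker_toeplitz (fun z => (theta z)^*).

(* n <= dim V, for a space V of analytic functions on the disc (possibly of
   infinite dimension) *)
Definition dim_ge (V : set (C -> C)) (n : nat) : Prop :=
  exists v : 'I_n -> C -> C,
    (forall i, V (v i)) /\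
    forall c : 'I_n -> C,
      (forall z, disc z -> \sum_(i < n) c i * v i z = 0) -> forall i, c i = 0.

Definition maximal_function g f : Prop :=
  [/\ ker_toeplitz g f,
      exists2 z, disc z & f z != 0
    & forall h, LinfT h -> ker_toeplitz h f ->
        ker_toeplitz g `<=` ker_toeplitz h].

Definition blaschke lam z : C := (z - lam) / (1 - lam^* * z).

(* At z = lam the quotient denotes its continuous extension theta'(lam). *)
Definition k_tilde theta lam z : C :=
  if z == lam then derive1 theta lam else (theta z - theta lam) / (z - lam).

Definition k_lam theta lam z : C :=
  (1 - (theta lam)^* * theta z) / (1 - lam^* * z).

(* The sequences I_n and O_n, with I_0 = I0 and O_0 = O0; lam 0 is not used. *)
Fixpoint innern (I0 : C -> C) (lam : nat -> C) (n : nat) : C -> C :=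
  if n is m.+1 then
    fun z => k_tilde (innern I0 lam m) (lam n) z
             / k_lam (innern I0 lam m) (lam n) z
  else I0.

Fixpoint outern (I0 O0 : C -> C) (lam : nat -> C) (n : nat) : C -> C :=
  if n is m.+1 then
    fun z => k_lam (innern I0 lam m) (lam n) z * (1 - (lam n)^* * z)
             * outern I0 O0 lam m z
  else O0.

End Hardy.

(* Main.v *)
Require Import Defs.
From mathcomp Require Import all_boot all_order all_algebra.
From mathcomp Require Import all_classical all_reals all_analysis.
From mathcomp Require Import measurable_realfun complex ring lra.
Import Order.TTheory GRing.Theory Num.Theory.
Import numFieldNormedType.Exports.

(** Why the theorem holds. On the circle an inner function I satisfies conj I
    = 1 / I. Hence, with a = I(lam) and w = 1 - conj(a) I, one step of the
    recursion satisfies there B_lam I_1 O_1 = (I - a) O = I O (1 - a conj I) =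
    I O conj(w). When |a| < 1 the function w is invertible in H^oo. Now f
    belongs to the kernel of T_h exactly when h f is orthogonal to H^2, and <h
    f conj(w), u> = <h f, w u>; so multiplying boundary values by conj(w) does
    not change the set of Toeplitz kernels to which a function belongs, and
    maximality is preserved ([maximal_twist]). Iterating over lam_1, ...,
    lam_N proves the first claim ([recursion_maximal]). The second follows
    from the first, since multiplication by the unimodular B exchanges ker T_h
    with ker T_(h conj B) ([maximal_factor]).

    The recursion must stay within inner functions and must keep |a| < 1. The
    maximum principle ([unimod_le1], [unimod_const]) gives |a| < 1 as soon as
    I is not constant, that is, as soon as its model space is nonzero
    ([inner_lt1]). A function f of the model space of I that vanishes at lam
    becomes, after multiplication by (1 - conj(lam) z) / ((z - lam) w), an
    element of the model space of I_1; so each step lowers the dimension by at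
    most one ([dim_kquot]), and dim K_I >= N suffices for N steps.

    That the new functions are in H^2 requires closure of H^2 under products
    with H^oo ([H2_mul]), difference quotients ([H2_k_tilde]) and reciprocals
    1 / (1 - a theta) ([Hinf_recip]). All three are read off from one
    description of H^2: a function with radial limits almost everywhere is in
    H^2 if and only if its boundary function is square integrable and its
    values in the disc are the Cauchy integrals of that boundary function
    ([H2_repr], [H2_of_repr]). The direct half rests on the mean-square
    convergence of the dilates of f to its boundary function, which combines
    Parseval's identity with Fatou's lemma ([H2_mean_square_cvg]). *)

Set Implicit Arguments.
Unset Strict Implicit.
Unset Printing Implicit Defensive.

Local Open Scope classical_set_scope.
Local Open Scope ring_scope.
Local Notation "x %:C" := (real_complex _ x) : ring_scope.
Local Notation "x +i* y" := (Complex x y) : ring_scope.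

(** * Complex numbers *)

Section ComplexBasics.
Variable R : realType.
Local Notation C := (Cx R).
Local Notation Re := (@complex.Re R).
Local Notation Im := (@complex.Im R).
Implicit Types (z w : C) (x y : R).

Lemma cReD z w : Re (z + w : C) = Re z + Re w. Proof. by case: z; case: w. Qed.
Lemma cImD z w : Im (z + w : C) = Im z + Im w. Proof. by case: z; case: w. Qed.
Lemma cReN z : Re (- z : C) = - Re z. Proof. by case: z. Qed.
Lemma cImN z : Im (- z : C) = - Im z. Proof. by case: z. Qed.
Lemma cReM z w : Re (z * w : C) = Re z * Re w - Im z * Im w.
Proof. by case: z; case: w. Qed.
Lemma cImM z w : Im (z * w : C) = Re z * Im w + Im z * Re w.
Proof. by case: z; case: w. Qed.

Lemma cjB z w : (z - w)^* = z^* - w^* :> C. Proof. exact: (rmorphB (@conjc R)). Qed.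
Lemma cjM z w : (z * w)^* = z^* * w^* :> C. Proof. exact: (rmorphM (@conjc R)). Qed.
Lemma cj1 : (1 : C)^* = 1 :> C. Proof. exact: (rmorph1 (@conjc R)). Qed.
Lemma cj0 : (0 : C)^* = 0 :> C. Proof. exact: (rmorph0 (@conjc R)). Qed.
Lemma cjV z : (z^-1)^* = (z^*)^-1 :> C. Proof. exact: (fmorphV (@conjc R)). Qed.
Lemma cjX z n : (z ^+ n)^* = (z^*) ^+ n :> C.
Proof. exact: (rmorphXn (@conjc R)). Qed.
Lemma cjK z : (z^*)^* = z :> C. Proof. exact: conjcK. Qed.
Lemma cj_eq0 z : ((z^* : C) == 0) = (z == 0). Proof. exact: conjc_eq0. Qed.

Lemma cnormE z : `|z| = (cabs z)%:C. Proof. by []. Qed.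
Lemma cabs_ge0 z : 0 <= cabs z. Proof. by case: z => a b; exact: sqrtr_ge0. Qed.
Lemma cabs0 : cabs (0 : C) = 0. Proof. exact: ComplexField.Normc.normc0. Qed.
Lemma cabs1 : cabs (1 : C) = 1. Proof. exact: ComplexField.Normc.normc1. Qed.
Lemma cabsM z w : cabs (z * w) = cabs z * cabs w.
Proof. exact: ComplexField.Normc.normcM. Qed.
Lemma cabsV z : cabs (z^-1) = (cabs z)^-1.
Proof. exact: ComplexField.Normc.normcV. Qed.
Lemma cabsD z w : cabs (z + w) <= cabs z + cabs w. Proof. exact: le_normcD. Qed.
Lemma cabsN z : cabs (- z) = cabs z. Proof. exact: normcN. Qed.
Lemma cabsB z w : cabs (z - w) <= cabs z + cabs w.
Proof. by rewrite -[cabs w]cabsN; exact: cabsD. Qed.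
Lemma cabsX z n : cabs (z ^+ n) = cabs z ^+ n.
Proof. by elim: n => [|n IH]; rewrite ?expr0 ?cabs1// !exprS cabsM IH. Qed.
Lemma cabs_eq0 z : (cabs z == 0) = (z == 0).
Proof.
by apply/eqP/eqP => [|->]; [exact: ComplexField.Normc.eq0_normc|exact: cabs0].
Qed.
Lemma cabs_sqr z : cabs z ^+ 2 = Re z ^+ 2 + Im z ^+ 2.
Proof. by case: z => a b; rewrite /cabs/= sqr_sqrtr// addr_ge0// sqr_ge0. Qed.
Lemma mulcJ z : z * z^* = (cabs z ^+ 2)%:C :> C.
Proof.
rewrite cabs_sqr; case: z => a b /=; rewrite /GRing.mul/=.
by congr (_ +i* _); ring.
Qed.
Lemma cabsJ z : cabs z^* = cabs z.
Proof. by case: z => a b; rewrite /cabs/= sqrrN. Qed.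
Lemma cabsR x : cabs (x%:C : C) = `|x|.
Proof. by rewrite /cabs/= expr0n/= addr0 sqrtr_sqr. Qed.
Lemma Re_le_cabs z : `|Re z| <= cabs z.
Proof.
rewrite -(@ler_pXn2r _ 2)// ?nnegrE ?cabs_ge0// cabs_sqr real_normK ?num_real//.
by rewrite lerDl sqr_ge0.
Qed.
Lemma Im_le_cabs z : `|Im z| <= cabs z.
Proof.
rewrite -(@ler_pXn2r _ 2)// ?nnegrE ?cabs_ge0// cabs_sqr real_normK ?num_real//.
by rewrite lerDr sqr_ge0.
Qed.
Lemma cabs_dist z w : `|cabs z - cabs w| <= cabs (z - w).
Proof.
have h1 := cabsD (z - w) w; have h2 := cabsD (w - z) z.
rewrite subrK in h1; rewrite subrK -(cabsN (w - z)) opprB in h2.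
by rewrite ler_norml; apply/andP; split; lra.
Qed.
Lemma cabs_le_ReIm z : cabs z <= `|Re z| + `|Im z|.
Proof.
rewrite {1}(_ : z = (Re z)%:C + (0 +i* 1 : C) * (Im z)%:C); last exact: complexE.
apply: le_trans (cabsD _ _) _; rewrite cabsM !cabsR.
by rewrite [cabs _](_ : _ = 1) ?mul1r// /cabs/= expr0n expr1n add0r sqrtr1.
Qed.
Lemma cabs_sum (I : Type) (s : seq I) (f : I -> C) :
  cabs (\sum_(i <- s) f i) <= \sum_(i <- s) cabs (f i).
Proof.
elim: s => [|a s IH]; first by rewrite !big_nil cabs0.
by rewrite !big_cons; apply: le_trans (cabsD _ _) _; rewrite lerD2l.
Qed.
Lemma RCM x y : (x * y)%:C = x%:C * y%:C :> C.
Proof. exact: (rmorphM (real_complex R)). Qed.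
Lemma RCX x n : (x ^+ n)%:C = x%:C ^+ n :> C.
Proof. exact: (rmorphXn (real_complex R)). Qed.

Lemma discE z : disc z <-> cabs z < 1.
Proof. by rewrite /disc/= cnormE -(ltcR (cabs z) 1). Qed.

(** The norm of [Cx R] has values in [Cx R]; this form of convergence gives
    access to the order of the reals. *)
Lemma cvgCP (T : Type) (F : set_system T) (FF : Filter F) (f : T -> C) (l : C) :
  f @ F --> l <-> (fun t => cabs (f t - l)) @ F --> (0 : R).
Proof.
split=> [/cvgrPdist_lt fl|fl].
  apply/cvgrPdist_lt => e e0.
  have /fl : 0 < (e%:C : C) by rewrite (ltcR 0 e).
  apply: filterS => t; rewrite cnormE ltcR => h.
  by rewrite sub0r normrN ger0_norm ?cabs_ge0// -cabsN opprB.
apply/cvgrPdist_lt => e e0.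
have [k ek] : exists k : R, e = k%:C by exists (Re e); case: e e0 => a b /=;
  rewrite ltcE/= => /andP[/eqP -> _].
move: e0; rewrite {e}ek (ltcR 0 k) => k0.
move/cvgrPdist_lt : fl => /(_ _ k0); apply: filterS => t.
rewrite sub0r normrN ger0_norm ?cabs_ge0// cnormE ltcR.
by rewrite -cabsN opprB.
Qed.

End ComplexBasics.

(** * Integration over the circle *)

Section CircleIntegral.
Variable R : realType.
Local Notation C := (Cx R).
Local Notation Re := (@complex.Re R).
Local Notation Im := (@complex.Im R).
Local Notation mu := (@lebesgue_measure R).
Local Notation circ := (@circ R).
Implicit Types (F G : R -> C) (g h : R -> R) (P : R -> Prop).

Definition rmeasurable g := measurable_fun circ g.
Definition rintegrable g := mu.-integrable circ (EFin \o g).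
Definition rmean g : R := (2 * pi)^-1 * \int[mu]_(t in circ) g t.
Definition cmeasurable F := rmeasurable (Re \o F) /\ rmeasurable (Im \o F).
Definition cintegrable F := rintegrable (Re \o F) /\ rintegrable (Im \o F).
Definition ae_circ P := {ae mu, forall t, circ t -> P t}.

Lemma measurable_circ : measurable circ. Proof. exact: measurable_itv. Qed.
Hint Resolve measurable_circ : core.

Lemma circ_pi : 0 < 2 * pi :> R. Proof. by rewrite mulr_gt0// pi_gt0. Qed.

Lemma mu_circ : mu circ = (2 * pi)%:E.
Proof.
by rewrite /circ lebesgue_measure_itv/= lte_fin circ_pi oppr0 adde0.
Qed.

Lemma ae_lebesgue_filter : Filter (almost_everywhere mu).
Proof. exact: (@ae_filter_ringOfSetsType _ (measurableTypeR R) R mu). Qed.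

Lemma ae_circS P Q : (forall t, circ t -> P t -> Q t) -> ae_circ P -> ae_circ Q.
Proof.
move=> PQ; apply: (@filterS _ _ ae_lebesgue_filter) => t h ct; exact: PQ (h ct).
Qed.
Lemma ae_circS2 P Q S : (forall t, circ t -> P t -> Q t -> S t) -> ae_circ P ->
  ae_circ Q -> ae_circ S.
Proof.
move=> PQ; apply: (@filterS2 _ _ ae_lebesgue_filter) => t h k ct;
  exact: PQ (h ct) (k ct).
Qed.
Lemma ae_circW P : (forall t, circ t -> P t) -> ae_circ P.
Proof. by move=> h; apply: aeW. Qed.

Lemma rintegrable_meas g : rintegrable g -> rmeasurable g.
Proof. by move=> /integrableP[/measurable_EFinP]. Qed.
Lemma cintegrable_meas F : cintegrable F -> cmeasurable F.
Proof. by case=> /rintegrable_meas ? /rintegrable_meas ?. Qed.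

Lemma rintegrableD g h : rintegrable g -> rintegrable h ->
  rintegrable (fun t => g t + h t).
Proof.
move=> ig ih;
  apply: (@eq_integrable _ _ _ mu circ _ (fun t => (g t)%:E + (h t)%:E)%E) => //.
exact: integrableD.
Qed.
Lemma rintegrableZ c g : rintegrable g -> rintegrable (fun t => c * g t).
Proof. by move=> ig;
  apply: (@eq_integrable _ _ _ mu circ _ (fun t => c%:E * (EFin \o g) t)%E) => //;
exact: integrableZl.
Qed.
Lemma rintegrable_cst c : rintegrable (fun=> c).
Proof.
apply/integrableP; split; first exact/measurable_EFinP/measurable_cst.
by rewrite [X in (X < _)%E](integral_cst mu _ `|c|%:E)//=
  [X in (_ * X < _)%E]mu_circ -EFinM ltry.
Qed.

Lemma rintegrable_ae_le g h : rmeasurable g -> rintegrable h ->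
  ae_circ (fun t => `|g t| <= h t) -> rintegrable g.
Proof.
move=> mg ih gh; apply/integrableP; split; first exact/measurable_EFinP.
have /integrableP[mh hoo] := ih.
apply: le_lt_trans hoo; apply: ae_ge0_le_integral => //.
- exact/measurableT_comp/measurable_EFinP.
- exact: measurableT_comp.
- apply: (@filterS _ _ ae_lebesgue_filter _ _ _ gh) => t hh ct; rewrite lee_fin;
    apply: le_trans (hh ct) _.
  exact: ler_norm.
Qed.

Lemma rmeanD g h : rintegrable g -> rintegrable h ->
  rmean (fun t => g t + h t) = rmean g + rmean h.
Proof. by move=> ig ih; rewrite /rmean RintegralD// mulrDr. Qed.
Lemma rmeanZ c g : rintegrable g -> rmean (fun t => c * g t) = c * rmean g.
Proof. by move=> ig; rewrite /rmean RintegralZl// mulrCA. Qed.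
Lemma rmean_cst c : rmean (fun=> c) = c.
Proof.
rewrite /rmean Rintegral_cst// [X in fine X]mu_circ/= mulrC mulfK//.
by rewrite gt_eqF ?circ_pi.
Qed.
Lemma eq_rmean g h : (forall t, circ t -> g t = h t) -> rmean g = rmean h.
Proof.
by move=> gh; rewrite /rmean; congr (_ * _); apply: eq_Rintegral => t;
  rewrite inE => /gh.
Qed.
Lemma eq_rintegrable g h : (forall t, circ t -> g t = h t) -> rintegrable g ->
  rintegrable h.
Proof. by move=> gh; apply: eq_integrable => // t; rewrite inE => /gh /= ->. Qed.
Lemma rmean_ge0 g : (forall t, circ t -> 0 <= g t) -> 0 <= rmean g.
Proof.
by move=> g0; rewrite mulr_ge0 ?Rintegral_ge0// invr_ge0 ltW// circ_pi.
Qed.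
Lemma eq_rmean_ae g h : rmeasurable g -> rmeasurable h ->
  ae_circ (fun t => g t = h t) -> rmean g = rmean h.
Proof.
move=> mg mh gh; rewrite /rmean /Rintegral; congr (_ * fine _);
  apply: ae_eq_integral => //.
- exact/measurable_EFinP.
- exact/measurable_EFinP.
- by apply: (@filterS _ _ ae_lebesgue_filter _ _ _ gh) => t hh ct /=;
    rewrite (hh ct).
Qed.
Lemma rmean_le g h : rintegrable g -> rintegrable h ->
  ae_circ (fun t => g t <= h t) -> rmean g <= rmean h.
Proof.
move=> ig ih gh.
have mg := rintegrable_meas ig; have mh := rintegrable_meas ih.
(* The maximum equals h almost everywhere and dominates g everywhere. *)
rewrite (@eq_rmean_ae h (fun t => Num.max (g t) (h t)))//.
- rewrite ler_wpM2l ?invr_ge0 ?(ltW circ_pi)//; apply: le_Rintegral => //.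
  + apply: (@rintegrable_ae_le _ (fun t => `|g t| + `|h t|)).
    * exact: measurable_maxr.
    * by apply: rintegrableD; exact: integrable_norm.
    * apply: ae_circW => t _; rewrite /Num.max; case: ifPn => _.
        by rewrite lerDr.
      by rewrite lerDl.
  + by move=> t _; rewrite le_max lexx.
- exact: measurable_maxr.
- by apply: ae_circS gh => t _ ght; rewrite max_r.
Qed.
Lemma rmean_eq0 g : rintegrable g -> (forall t, circ t -> 0 <= g t) ->
  rmean g <= 0 -> ae_circ (fun t => g t = 0).
Proof.
move=> ig g0 g00; have /integrableP[mg _] := ig.
have [+ _] := @ae_eq_integral_abs _ _ _ mu circ measurable_circ (EFin \o g) mg.
have e : (\int[mu]_(x in circ) `|(EFin \o g) x| = \int[mu]_(x in circ) (g x)%:E)%E.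
  by apply: eq_integral => t; rewrite inE => ct /=; rewrite ger0_norm// g0.
rewrite e => h; have {}h : (\int[mu]_(x in circ) (g x)%:E = 0)%E ->
  ae_circ (fun t => g t = 0).
  by move=> /h; apply: (@filterS _ _ ae_lebesgue_filter) => t hh ct; have [] :=
    hh ct.
apply: h; rewrite -[LHS]fineK; last exact: integrable_fin_num.
congr (_%:E); apply/eqP; rewrite eq_le fine_ge0 ?integral_ge0 ?andbT//.
by move: g00; rewrite /rmean pmulr_rle0// invr_gt0 circ_pi.
Qed.

Lemma cmeasurableD F G : cmeasurable F -> cmeasurable G ->
  cmeasurable (fun t => F t + G t).
Proof.
move=> [f1 f2] [g1 g2]; split.
- rewrite [X in rmeasurable X](_ : _ = (Re \o F) \+ (Re \o G));
    last by apply/funext => t /=; exact: cReD.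
  exact: measurable_funD.
- rewrite [X in rmeasurable X](_ : _ = (Im \o F) \+ (Im \o G));
    last by apply/funext => t /=; exact: cImD.
  exact: measurable_funD.
Qed.
Lemma cmeasurableM F G : cmeasurable F -> cmeasurable G ->
  cmeasurable (fun t => F t * G t).
Proof.
move=> [f1 f2] [g1 g2]; split.
- rewrite [X in rmeasurable X](_ : _ =
    ((fun t => (Re \o F) t * (Re \o G) t) \- (fun t => (Im \o F) t * (Im \o G) t)));
      last by apply/funext => t /=; exact: cReM.
  by apply: measurable_funB; exact: measurable_funM.
- rewrite [X in rmeasurable X](_ : _ =
    ((fun t => (Re \o F) t * (Im \o G) t) \+ (fun t => (Im \o F) t * (Re \o G) t)));
      last by apply/funext => t /=; exact: cImM.
  by apply: measurable_funD; exact: measurable_funM.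
Qed.
Lemma cmeasurable_cst c : cmeasurable (fun=> c).
Proof. by split; exact: measurable_cst. Qed.
Lemma cmeasurable_real g : rmeasurable g -> cmeasurable (fun t => (g t)%:C).
Proof. by move=> mg; split=> //; exact: measurable_cst. Qed.
Lemma cmeasurableJ F : cmeasurable F -> cmeasurable (fun t => (F t)^*).
Proof.
move=> [f1 f2]; split.
- by rewrite [X in rmeasurable X](_ : _ = Re \o F)//; apply/funext => t /=;
    case: (F t).
- rewrite [X in rmeasurable X](_ : _ = \- (Im \o F)); last by apply/funext => t /=;
    case: (F t).
  exact: measurable_funN.
Qed.
Lemma cmeasurableN F : cmeasurable F -> cmeasurable (fun t => - F t).
Proof.
move=> mF; rewrite [X in cmeasurable X](_ : _ = fun t => -1 * F t);
  last by apply/funext => t; rewrite mulN1r.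
exact: cmeasurableM (cmeasurable_cst _) mF.
Qed.
Lemma cmeasurableB F G : cmeasurable F -> cmeasurable G ->
  cmeasurable (fun t => F t - G t).
Proof. by move=> mF mG; apply: cmeasurableD mF (cmeasurableN mG). Qed.
Lemma cmeasurableX F n : cmeasurable F -> cmeasurable (fun t => F t ^+ n).
Proof.
move=> mF; elim: n => [|n IH]; first exact: cmeasurable_cst.
rewrite [X in cmeasurable X](_ : _ = fun t => F t * F t ^+ n);
  first exact: cmeasurableM.
by apply/funext => t; rewrite exprS.
Qed.
Lemma rmeasurable_cabs2 F : cmeasurable F -> rmeasurable (fun t => cabs (F t) ^+ 2).
Proof.
move=> [f1 f2].
rewrite [X in rmeasurable X](_ : _ =
  (fun t => (Re \o F) t ^+ 2) \+ (fun t => (Im \o F) t ^+ 2)).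
  by apply: measurable_funD; exact: measurable_funX.
by apply/funext => t /=; rewrite cabs_sqr.
Qed.
Lemma rmeasurable_cabs F : cmeasurable F -> rmeasurable (fun t => cabs (F t)).
Proof.
move=> mF; rewrite
  [X in rmeasurable X](_ : _ =
    (fun x => powR x (2^-1)) \o (fun t => cabs (F t) ^+ 2)).
  apply: measurableT_comp; last exact: rmeasurable_cabs2.
  exact: measurable_powR.
apply/funext => t /=; rewrite powR12_sqrt ?sqr_ge0// sqrtr_sqr ger0_norm//.
exact: cabs_ge0.
Qed.
Lemma cmeasurableV F : cmeasurable F -> cmeasurable (fun t => (F t)^-1).
Proof.
move=> mF; rewrite
  [X in cmeasurable X](_ : _ =
    (fun t => (F t)^* * (powR (cabs (F t) ^+ 2) (-1))%:C)).
  apply: cmeasurableM (cmeasurableJ mF) _; apply: cmeasurable_real.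
  apply: (@measurableT_comp _ _ _ _ _ _ (fun x => powR x (-1)));
    last exact: rmeasurable_cabs2.
  exact: measurable_powR.
apply/funext => t; rewrite powR_inv1 ?sqr_ge0//.
have [->|Ft] := eqVneq (F t) 0; first by rewrite invr0 cj0 mul0r.
apply: (mulfI Ft); rewrite mulfV// mulrA mulcJ -RCM mulfV//.
by rewrite sqrf_eq0 cabs_eq0.
Qed.

Lemma cintegrable_ae_le F h : cmeasurable F -> rintegrable h ->
  ae_circ (fun t => cabs (F t) <= h t) -> cintegrable F.
Proof.
move=> [m1 m2] ih Fh; split; apply: rintegrable_ae_le ih _ => //;
  apply: ae_circS Fh => t _ /=; apply: le_trans.
  exact: Re_le_cabs.
exact: Im_le_cabs.
Qed.
Lemma cintegrable_cabs F : cintegrable F -> rintegrable (fun t => cabs (F t)).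
Proof.
move=> iF; have [i1 i2] := iF.
apply: (@rintegrable_ae_le _ (fun t => `|Re (F t)| + `|Im (F t)|)).
- exact: rmeasurable_cabs (cintegrable_meas iF).
- by apply: rintegrableD; [exact: integrable_norm i1|exact: integrable_norm i2].
- by apply: ae_circW => t _; rewrite ger0_norm ?cabs_ge0// cabs_le_ReIm.
Qed.
Lemma cintegrableD F G : cintegrable F -> cintegrable G ->
  cintegrable (fun t => F t + G t).
Proof.
move=> [f1 f2] [g1 g2]; split.
- by apply: eq_rintegrable (rintegrableD f1 g1) => t _ /=; rewrite cReD.
- by apply: eq_rintegrable (rintegrableD f2 g2) => t _ /=; rewrite cImD.
Qed.
Lemma cintegrable_bddM F G M : cmeasurable F ->
  ae_circ (fun t => cabs (F t) <= M) -> cintegrable G ->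
    cintegrable (fun t => F t * G t).
Proof.
move=> mF FM iG; apply: (@cintegrable_ae_le _ (fun t => M * cabs (G t))).
- exact: cmeasurableM (cintegrable_meas iG).
- exact/rintegrableZ/cintegrable_cabs.
- by apply: ae_circS FM => t _ h; rewrite cabsM ler_wpM2r// cabs_ge0.
Qed.
Lemma cintegrableZ c F : cintegrable F -> cintegrable (fun t => c * F t).
Proof.
move=> iF; apply: (@cintegrable_bddM _ _ (cabs c)) => //;
  first exact: cmeasurable_cst.
exact: ae_circW.
Qed.
Lemma cintegrableJ F : cintegrable F -> cintegrable (fun t => (F t)^*).
Proof.
move=> iF; apply: cintegrable_ae_le (cmeasurableJ (cintegrable_meas iF))
  (cintegrable_cabs iF) _.
by apply: ae_circW => t _; rewrite cabsJ.
Qed.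
Lemma cintegrable_cst c : cintegrable (fun=> c).
Proof. by split; exact: rintegrable_cst. Qed.
Lemma cintegrableN F : cintegrable F -> cintegrable (fun t => - F t).
Proof.
move=> iF; rewrite [X in cintegrable X](_ : _ = fun t => -1 * F t);
  first exact: cintegrableZ.
by apply/funext => t; rewrite mulN1r.
Qed.
Lemma cintegrableB F G : cintegrable F -> cintegrable G ->
  cintegrable (fun t => F t - G t).
Proof. by move=> iF iG; exact: cintegrableD iF (cintegrableN iG). Qed.
Lemma cintegrable_real g : rintegrable g -> cintegrable (fun t => (g t)%:C).
Proof. by move=> ig; split=> //; exact: (rintegrable_cst 0). Qed.
Lemma eq_cintegrable F G : (forall t, circ t -> F t = G t) -> cintegrable F ->
  cintegrable G.
Proof.
by move=> FG [f1 f2]; split;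
  [apply: eq_rintegrable f1|apply: eq_rintegrable f2] => t /FG /= ->.
Qed.

Lemma cmeanE F : cmean F = rmean (Re \o F) +i* rmean (Im \o F) :> C.
Proof. by []. Qed.
Lemma cmean_real g : cmean (fun t => (g t)%:C) = (rmean g)%:C :> C.
Proof. by rewrite cmeanE; congr (_ +i* _); exact: (rmean_cst 0). Qed.
Lemma cmeanD F G : cintegrable F -> cintegrable G ->
  cmean (fun t => F t + G t) = cmean F + cmean G :> C.
Proof.
move=> [f1 f2] [g1 g2]; rewrite !cmeanE.
rewrite (@eq_rmean _ (fun t => (Re \o F) t + (Re \o G) t)); last by move=> t _ /=;
  rewrite cReD.
rewrite (@eq_rmean (Im \o _) (fun t => (Im \o F) t + (Im \o G) t));
  last by move=> t _ /=; rewrite cImD.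
by rewrite !rmeanD.
Qed.
Lemma cmeanZ c F : cintegrable F -> cmean (fun t => c * F t) = c * cmean F :> C.
Proof.
move=> [f1 f2]; rewrite !cmeanE.
rewrite (@eq_rmean _ (fun t => Re c * (Re \o F) t + (- Im c) * (Im \o F) t));
  last first.
  by move=> t _ /=; rewrite cReM mulNr.
rewrite (@eq_rmean (Im \o _) (fun t => Re c * (Im \o F) t + Im c * (Re \o F) t));
  last first.
  by move=> t _ /=; rewrite cImM.
rewrite !rmeanD ?rmeanZ; try exact: rintegrableZ; try by [].
by rewrite {3}(_ : c = Re c +i* Im c) ?mulNr//; case: (c).
Qed.
Lemma eq_cmean F G : (forall t, circ t -> F t = G t) -> cmean F = cmean G :> C.
Proof.
by move=> FG; rewrite !cmeanE; congr (_ +i* _); apply: eq_rmean => t ct /=;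
  rewrite FG.
Qed.
Lemma cmeanN F : cintegrable F -> cmean (fun t => - F t) = - cmean F :> C.
Proof.
move=> iF; rewrite -mulN1r -cmeanZ//; apply: eq_cmean => t _; by rewrite mulN1r.
Qed.
Lemma cmeanB F G : cintegrable F -> cintegrable G ->
  cmean (fun t => F t - G t) = cmean F - cmean G :> C.
Proof. by move=> iF iG; rewrite cmeanD ?cmeanN//; exact: cintegrableN. Qed.
Lemma cmeanJ F : cintegrable F -> cmean (fun t => (F t)^*) = (cmean F)^* :> C.
Proof.
move=> [f1 f2]; rewrite !cmeanE; apply/eqP; rewrite eq_complex /=; apply/andP;
  split; apply/eqP.
  by apply: eq_rmean => t _ /=; case: (F t).
rewrite -mulN1r -rmeanZ//.
by apply: eq_rmean => t _ /=; case: (F t) => a b /=; rewrite mulN1r.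
Qed.
Lemma eq_cmean_ae F G : cmeasurable F -> cmeasurable G ->
  ae_circ (fun t => F t = G t) -> cmean F = cmean G :> C.
Proof.
move=> [f1 f2] [g1 g2] FG; rewrite !cmeanE; congr (_ +i* _);
  apply: eq_rmean_ae => //;
by apply: ae_circS FG => t _ /= ->.
Qed.
Lemma cmean_cst c : cmean (fun=> c) = c :> C.
Proof. by rewrite cmeanE /= !rmean_cst; case: c. Qed.

Lemma Re_cmean F : Re (cmean F) = rmean (fun t => Re (F t)).
Proof. by []. Qed.

(** Rotating the mean onto the positive real axis reduces the inequality to
    real parts. *)
Lemma cmean_le F : cintegrable F -> cabs (cmean F) <= rmean (fun t => cabs (F t)).
Proof.
move=> iF; set m : C := cmean F.
have [m0|m0] := eqVneq m 0.
  by rewrite m0 cabs0 rmean_ge0// => t _; exact: cabs_ge0.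
have cm : 0 < cabs m by rewrite lt_neqAle cabs_ge0 eq_sym cabs_eq0 m0.
rewrite -(ler_pM2l cm) -expr2.
have -> : cabs m ^+ 2 = Re (cmean (fun t => m^* * F t)).
  by rewrite cmeanZ// mulrC mulcJ.
rewrite Re_cmean -rmeanZ; last exact: cintegrable_cabs.
apply: rmean_le.
- by have [] := cintegrableZ m^* iF.
- exact/rintegrableZ/cintegrable_cabs.
- apply: ae_circW => t _; apply: le_trans (ler_norm _) _;
    apply: le_trans (Re_le_cabs _) _.
  by rewrite cabsM cabsJ.
Qed.

Lemma cmean_le_ae F h : cintegrable F -> rintegrable h ->
  ae_circ (fun t => cabs (F t) <= h t) ->
  cabs (cmean F) <= rmean h.
Proof.
by move=> iF ih Fh;
  apply: le_trans (cmean_le iF) (rmean_le (cintegrable_cabs iF) ih Fh).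
Qed.

Lemma cintegrable_sum (F_ : nat -> R -> C) n : (forall k, cintegrable (F_ k)) ->
  cintegrable (fun t => \sum_(k < n) (F_ k t : C)).
Proof.
move=> iF; elim: n => [|n IH].
  by apply: eq_cintegrable (cintegrable_cst 0) => t _; rewrite big_ord0.
by apply: eq_cintegrable (cintegrableD IH (iF n)) => t _; rewrite big_ord_recr.
Qed.

Lemma cmean_sum (F_ : nat -> R -> C) n : (forall k, cintegrable (F_ k)) ->
  cmean (fun t => \sum_(k < n) (F_ k t : C)) = \sum_(k < n) (cmean (F_ k) : C).
Proof.
move=> iF; elim: n => [|n IH].
  by rewrite big_ord0 -[RHS]cmean_cst; apply: eq_cmean => t _; rewrite big_ord0.
rewrite big_ord_recr /= -IH -cmeanD//; last exact: (@cintegrable_sum F_).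
by apply: eq_cmean => t _; rewrite big_ord_recr.
Qed.

Lemma cmeasurable_cvg (F_ : nat -> R -> C) F : (forall n, cmeasurable (F_ n)) ->
  (forall t, circ t -> (fun n => F_ n t) @ \oo --> F t) -> cmeasurable F.
Proof.
move=> mF cF; split.
- apply: (@measurable_fun_cvg _ _ _ circ (fun n => Re \o F_ n)) => [m|t ct];
    first by have [] := mF m.
  have /cvgCP h := cF t ct; apply/cvgrPdist_le => e e0.
  move/cvgrPdist_le : h => /(_ _ e0); apply: filterS => n;
    rewrite sub0r normrN ger0_norm ?cabs_ge0//.
  by apply: le_trans; rewrite distrC -cReN -cReD; exact: Re_le_cabs.
- apply: (@measurable_fun_cvg _ _ _ circ (fun n => Im \o F_ n)) => [m|t ct];
    first by have [] := mF m.
  have /cvgCP h := cF t ct; apply/cvgrPdist_le => e e0.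
  move/cvgrPdist_le : h => /(_ _ e0); apply: filterS => n;
    rewrite sub0r normrN ger0_norm ?cabs_ge0//.
  by apply: le_trans; rewrite distrC -cImN -cImD; exact: Im_le_cabs.
Qed.

Lemma rmean_cvg0 (g_ : nat -> R -> R) h : (forall n, rmeasurable (g_ n)) ->
  rintegrable h ->
  (forall n t, circ t -> 0 <= g_ n t <= h t) ->
  (forall t, circ t -> (fun n => g_ n t) @ \oo --> (0 : R)) ->
  (fun n => rmean (g_ n)) @ \oo --> (0 : R).
Proof.
move=> mg ih gh g0.
have [] := @dominated_convergence _ _ _ mu circ measurable_circ (fun n =>
  EFin \o g_ n) (cst 0%E) (EFin \o h) _ _ _ ih.
- by move=> n; apply/measurable_EFinP; exact: mg.
- exact: measurable_cst.
- by apply: aeW => t ct; apply: cvg_EFin; [exact: nearW|exact: g0].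
- by apply: aeW => t n ct /=; have /andP[a b] := gh n t ct;
    rewrite lee_fin ger0_norm.
move=> _ _; rewrite integral0 => h0.
rewrite -[X in _ --> X](mulr0 ((2 * pi)^-1)); apply: cvgMr => //.
exact: (fine_cvg h0).
Qed.

(** Dominated convergence, applied to the real functions |F_n - F|. *)
Lemma cmean_cvg (F_ : nat -> R -> C) F h : (forall n, cmeasurable (F_ n)) ->
  rintegrable h ->
  (forall n t, circ t -> cabs (F_ n t) <= h t) ->
  (forall t, circ t -> (fun n => F_ n t) @ \oo --> F t) ->
  cintegrable F /\ (fun n => cmean (F_ n)) @ \oo --> cmean F.
Proof.
move=> mF ih Fh Fc.
have mF' : cmeasurable F by apply: cmeasurable_cvg Fc.
have Fh' t : circ t -> cabs (F t) <= h t.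
  move=> ct; have /cvgCP c := Fc t ct.
  rewrite -subr_le0; apply: (cvgr_to_ge c); apply: nearW => n.
  rewrite lerBlDr -{1}[F t](subrK (F_ n t)).
  apply: le_trans (cabsD _ _) _.
  by apply: lerD; [rewrite -cabsN opprB|exact: Fh].
have iF : cintegrable F by apply: cintegrable_ae_le ih _ => //; exact: ae_circW.
have iFn n : cintegrable (F_ n) by apply: cintegrable_ae_le ih _ => //;
  apply: ae_circW; exact: Fh.
split=> //; apply/cvgCP.
apply: (@squeeze_cvgr _ _ _ _ (cst 0) (fun n =>
  rmean (fun t => cabs (F_ n t - F t)))).
- apply: nearW => n; rewrite cabs_ge0 andTb -cmeanB//.
  exact/cmean_le/cintegrableB.
- exact: cvg_cst.
- apply: (@rmean_cvg0 _ (fun t => h t + h t)).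
  + by move=> n; apply: rmeasurable_cabs; exact: cmeasurableB.
  + exact: rintegrableD.
  + move=> n t ct; rewrite cabs_ge0/=; apply: le_trans (cabsB _ _) _.
    by apply: lerD; [exact: Fh|exact: Fh'].
  + by move=> t ct; apply/cvgCP; exact: Fc.
Qed.

End CircleIntegral.

(** * Square-integrable functions and exponentials *)

Section Quadratic.
Variable R : realType.
Local Notation C := (Cx R).
Local Notation Re := (@complex.Re R).
Local Notation Im := (@complex.Im R).
Local Notation mu := (@lebesgue_measure R).
Local Notation circ := (@circ R).
Implicit Types (F G : R -> C) (g h : R -> R).

Definition sqint F := cmeasurable F /\ rintegrable (fun t => cabs (F t) ^+ 2).

Lemma amgm (x y : R) : x * y <= x ^+ 2 + y ^+ 2.
Proof. nra. Qed.

Lemma amgm_weighted (d x y : R) : 0 < d -> 0 <= x -> 0 <= y ->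
  x * y <= d^-1 * x ^+ 2 + d * y ^+ 2.
Proof.
move=> d0 x0 y0; rewrite -(ler_pM2l d0) mulrDr (mulrA d d^-1) mulfV ?gt_eqF// mul1r.
have := sqr_ge0 (x - d * y); have := mulr_ge0 x0 (mulr_ge0 (ltW d0) y0); nra.
Qed.

Lemma sqint_cintegrableM F G : sqint F -> sqint G ->
  cintegrable (fun t => F t * G t).
Proof.
move=> [mF iF] [mG iG];
  apply: (cintegrable_ae_le (cmeasurableM mF mG) (rintegrableD iF iG)).
by apply: ae_circW => t _; rewrite cabsM; exact: amgm.
Qed.
Lemma sqint_bddM F G M : cmeasurable F -> ae_circ (fun t => cabs (F t) <= M) ->
  sqint G -> sqint (fun t => F t * G t).
Proof.
move=> mF FM [mG iG]; split; first exact: cmeasurableM.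
apply: (@rintegrable_ae_le _ _ (fun t => M ^+ 2 * cabs (G t) ^+ 2)).
- exact: rmeasurable_cabs2 (cmeasurableM mF mG).
- exact: rintegrableZ.
- apply: ae_circS FM => t _ h;
    rewrite ger0_norm ?sqr_ge0// cabsM exprMn ler_wpM2r ?sqr_ge0//.
  by rewrite ler_pXn2r ?nnegrE ?cabs_ge0// (le_trans (cabs_ge0 _) h).
Qed.
Lemma sqint_cst c : sqint (fun=> c).
Proof. by split; [exact: cmeasurable_cst|exact: rintegrable_cst]. Qed.
Lemma sqint_bdd F M : cmeasurable F -> ae_circ (fun t => cabs (F t) <= M) ->
  sqint F.
Proof.
move=> mF FM; rewrite (_ : F = fun t => F t * 1); last by apply/funext => t;
  rewrite mulr1.
exact: sqint_bddM mF FM (sqint_cst 1).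
Qed.
Lemma sqintZ c F : sqint F -> sqint (fun t => c * F t).
Proof.
by apply: (@sqint_bddM _ _ (cabs c)); [exact: cmeasurable_cst|exact: ae_circW].
Qed.
Lemma sqintD F G : sqint F -> sqint G -> sqint (fun t => F t + G t).
Proof.
move=> [mF iF] [mG iG]; split; first exact: cmeasurableD.
apply: (@rintegrable_ae_le _ _ (fun t => 2 * (cabs (F t) ^+ 2 + cabs (G t) ^+ 2))).
- exact: rmeasurable_cabs2 (cmeasurableD mF mG).
- by apply: rintegrableZ; exact: rintegrableD.
- apply: ae_circW => t _; rewrite ger0_norm ?sqr_ge0//.
  have h := cabsD (F t) (G t); have h0 := cabs_ge0 (F t + G t).
  apply: (@le_trans _ _ ((cabs (F t) + cabs (G t)) ^+ 2)).
    by rewrite ler_pXn2r ?nnegrE ?addr_ge0 ?cabs_ge0.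
  have := sqr_ge0 (cabs (F t) - cabs (G t)); nra.
Qed.
Lemma sqintN F : sqint F -> sqint (fun t => - F t).
Proof.
move=> [mF iF]; split; first exact: cmeasurableN.
by apply: eq_rintegrable iF => t _; rewrite cabsN.
Qed.
Lemma sqintB F G : sqint F -> sqint G -> sqint (fun t => F t - G t).
Proof. by move=> cF cG; exact: sqintD cF (sqintN cG). Qed.
Lemma sqintJ F : sqint F -> sqint (fun t => (F t)^*).
Proof.
move=> [mF iF]; split; first exact: cmeasurableJ.
by apply: eq_rintegrable iF => t _; rewrite cabsJ.
Qed.
Lemma sqint_cintegrable F : sqint F -> cintegrable F.
Proof.
move=> cF; apply: eq_cintegrable (sqint_cintegrableM cF (sqint_cst 1)) => t _;
  exact: mulr1.
Qed.
Lemma sqint_norm F : sqint F ->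
  cmean (fun t => F t * (F t)^*) = (rmean (fun t => cabs (F t) ^+ 2))%:C :> C.
Proof.
by move=> cF; rewrite -cmean_real; apply: eq_cmean => t _; rewrite [LHS]mulcJ.
Qed.

(** A weighted form of the Cauchy-Schwarz inequality, in which the free
    weight d replaces square roots. *)
Lemma cmean_cs F G (d : R) : sqint F -> sqint G -> 0 < d ->
  cabs (cmean (fun t => F t * G t)) <=
  d^-1 * rmean (fun t => cabs (F t) ^+ 2) + d * rmean (fun t => cabs (G t) ^+ 2).
Proof.
move=> cF cG d0; have [mF iF] := cF; have [mG iG] := cG.
rewrite -!rmeanZ// -rmeanD; try exact: rintegrableZ.
apply: cmean_le_ae; first exact: sqint_cintegrableM.
- by apply: rintegrableD; exact: rintegrableZ.
- by apply: ae_circW => t _; rewrite cabsM; apply: amgm_weighted => //;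
    exact: cabs_ge0.
Qed.

Lemma sqint_cvg (F_ : nat -> R -> C) F G : (forall n, sqint (F_ n)) -> sqint F ->
  sqint G ->
  (fun n => rmean (fun t => cabs (F_ n t - F t) ^+ 2)) @ \oo --> (0 : R) ->
  (fun n => cmean (fun t => F_ n t * G t)) @ \oo -->
    (cmean (fun t => F t * G t) : C).
Proof.
move=> cFn cF cG h; apply/cvgCP.
set g2 := rmean (fun t => cabs (G t) ^+ 2).
have g20 : 0 <= g2 by apply: rmean_ge0 => t _; exact: sqr_ge0.
apply/cvgrPdist_lt => e e0.
(* This d makes the term of [cmean_cs] that involves G at most e / 2. *)
pose d := e / (2 * (g2 + 1)).
have d0 : 0 < d by rewrite divr_gt0// mulr_gt0// ltr_wpDl.
move/cvgrPdist_lt : h => /(_ (d * (e / 2))).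
have -> : 0 < d * (e / 2) by rewrite mulr_gt0// divr_gt0.
move=> /(_ isT); apply: filterS => n; rewrite !sub0r !normrN.
set m := rmean _; have m0 : 0 <= m by apply: rmean_ge0 => t _; exact: sqr_ge0.
rewrite !ger0_norm ?cabs_ge0// => hm.
rewrite -cmeanB; try exact: sqint_cintegrableM.
rewrite (@eq_cmean _ _ (fun t => (F_ n t - F t) * G t)); last by move=> t _;
  rewrite mulrBl.
apply: le_lt_trans (cmean_cs (sqintB (cFn n) cF) cG d0) _.
rewrite -/m -/g2 [ltRHS](splitr e) ltr_leD//.
  by rewrite mulrC ltr_pdivrMr// mulrC.
have -> : e / 2 = d * (g2 + 1).
  by rewrite /d; field; rewrite gt_eqF// ltr_wpDl.
by rewrite ler_wpM2l ?(ltW d0)// lerDl.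
Qed.

Lemma cabs_expi (t : R) : cabs (expi t : C) = 1.
Proof. by rewrite /cabs /expi /= cos2Dsin2 sqrtr1. Qed.
Lemma expiJ (t : R) : expi t * (expi t)^* = 1 :> C.
Proof. by rewrite [LHS]mulcJ cabs_expi expr1n. Qed.
Lemma cmeasurable_expi : cmeasurable (@expi R : R -> C).
Proof.
split; apply: measurable_funTS; apply: continuous_measurable_fun.
- exact: continuous_cos.
- exact: continuous_sin.
Qed.
Lemma expiX (t : R) n : expi t ^+ n = expi (n%:R * t) :> C.
Proof.
elim: n => [|n IH].
  by rewrite expr0 mul0r /expi cos0 sin0.
rewrite exprS IH -natr1 mulrDl mul1r addrC /expi cosD sinD.
by rewrite /GRing.mul /=; congr (_ +i* _); rewrite addrC.
Qed.

Lemma circ_int_derive (f S : R -> R) : (forall x : R, is_derive x (1:R) S (f x)) ->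
  continuous f -> S (2 * pi) = S 0 -> \int[mu]_(t in circ) f t = 0.
Proof.
move=> dS cf S0.
have cS (x : R) : {for x, continuous S}.
  by apply: differentiable_continuous; apply/derivable1_diffP; exact: ex_derive.
rewrite /Rintegral (@continuous_FTC2 _ f S) ?circ_pi ?S0 ?subee//.
- exact: continuous_subspaceT.
- split.
  + by move=> x _; exact: ex_derive.
  + by apply: cvg_at_right_filter; exact: cS.
  + by apply: cvg_at_left_filter; exact: cS.
- by move=> x _; rewrite derive1E; exact: derive_val.
Qed.

Lemma is_derive_scale (x a : R) : is_derive x (1:R) (fun t : R => a * t) a.
Proof.
have -> : (fun t : R => a * t) = a \*: id by [].
by apply: is_derive_eq; rewrite /GRing.scale /= mulr1.
Qed.

Lemma npi_period n : n%:R * (2 * pi) = pi *+ 2 *+ n :> R.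
Proof. by rewrite mulrA -natrM mulr_natl mulnC mulrnA. Qed.

Lemma cmean_expi n : (0 < n)%N -> cmean (fun t => expi t ^+ n) = 0 :> C.
Proof.
move=> n0; have nR : (n%:R : R) != 0 by rewrite pnatr_eq0 -lt0n.
rewrite cmeanE /rmean.
have -> : \int[mu]_(t in circ) (Re \o (fun t0 => expi t0 ^+ n)) t = 0.
  rewrite (@eq_Rintegral _ _ _ mu circ (fun t => cos (n%:R * t)));
    last by move=> t _ /=; rewrite expiX.
  apply: (@circ_int_derive _ (fun t => n%:R^-1 * sin (n%:R * t))).
  - move=> x; have h2 :=
      @is_derive1_comp R sin _ x _ _ (is_derive_sin _) (is_derive_scale x n%:R).
    have h3 := is_deriveZ (n%:R^-1) h2.
    by apply: is_derive_eq h3 _; rewrite /GRing.scale /= mulrCA mulVf// mulr1.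
  - by move=> x; apply: continuous_comp;
      [exact: mulrl_continuous|exact: continuous_cos].
  - by rewrite npi_period -[pi *+ 2 *+ n]add0r (periodicn (@sinD2pi R)) mulr0.
have -> : \int[mu]_(t in circ) (Im \o (fun t0 => expi t0 ^+ n)) t = 0.
  rewrite (@eq_Rintegral _ _ _ mu circ (fun t => sin (n%:R * t)));
    last by move=> t _ /=; rewrite expiX.
  apply: (@circ_int_derive _ (fun t => (- n%:R^-1) * cos (n%:R * t))).
  - move=> x; have h2 :=
      @is_derive1_comp R cos _ x _ _ (is_derive_cos _) (is_derive_scale x n%:R).
    have h3 := is_deriveZ (- n%:R^-1) h2.
    by apply: is_derive_eq h3 _;
      rewrite /GRing.scale /= mulNr mulrCA mulVf// mulr1 opprK.
  - by move=> x; apply: continuous_comp;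
      [exact: mulrl_continuous|exact: continuous_sin].
  - by rewrite npi_period -[pi *+ 2 *+ n]add0r (periodicn (@cosD2pi R)) mulr0.
by rewrite !mulr0.
Qed.

Lemma cabs_expiX (t : R) n : cabs (expi t ^+ n : C) = 1.
Proof. by rewrite cabsX cabs_expi expr1n. Qed.

Lemma sqint_expiX n : sqint (fun t => expi t ^+ n).
Proof.
apply: (@sqint_bdd _ 1); first exact: cmeasurableX cmeasurable_expi.
by apply: ae_circW => t _; rewrite cabs_expiX.
Qed.

Lemma cmean_expi_ortho m n : cmean (fun t => expi t ^+ m * (expi t ^+ n)^*) =
  (m == n)%:R :> C.
Proof.
wlog mn : m n / (n <= m)%N.
  move=> H; have [nm|mn] := leqP n m; first exact: H.
  have i : cintegrable (fun t => expi t ^+ n * (expi t ^+ m)^* : C).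
    exact: sqint_cintegrableM (sqint_expiX n) (sqintJ (sqint_expiX m)).
  rewrite (@eq_cmean _ _ (fun t => (expi t ^+ n * (expi t ^+ m)^*)^*)); last first.
    by move=> t _; rewrite cjM cjK mulrC.
  rewrite cmeanJ// H 1?ltnW// eq_sym; case: eqP => _; [exact: cj1|exact: cj0].
have e t : expi t ^+ m * (expi t ^+ n)^* = expi t ^+ (m - n) :> C.
  by rewrite -{1}(subnK mn) exprD -mulrA cjX -exprMn expiJ expr1n mulr1.
rewrite (eq_cmean (fun t _ => e t)).
have [->|mn'] := eqVneq m n.
  by rewrite subnn -[RHS]cmean_cst; apply: eq_cmean => t _; rewrite expr0.
by rewrite cmean_expi// subn_gt0 ltn_neqAle eq_sym mn'.
Qed.

Lemma geom_sum_le (q : R) n : 0 <= q < 1 -> \sum_(0 <= k < n) q ^+ k <= (1 - q)^-1.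
Proof.
move=> /andP[q0 q1].
have -> : \sum_(0 <= k < n) q ^+ k = (1 - q ^+ n) / (1 - q).
  apply/(mulIf (_ : 1 - q != 0)); first by rewrite subr_eq0 eq_sym lt_eqF.
  rewrite mulfVK; last by rewrite subr_eq0 eq_sym lt_eqF.
  elim: n => [|n IH]; first by rewrite big_nil expr0 subrr mul0r.
  by rewrite big_nat_recr//= mulrDl IH exprS; ring.
by rewrite ler_piMl ?invr_ge0 ?subr_ge0 ?(ltW q1)// gerBl exprn_ge0.
Qed.

(** Termwise integration against G, by dominated convergence with M / (1 -
    q) times |G|. It serves for the powers of e^(it) and for their
    conjugates. *)
Lemma cmean_series (c : nat -> C) (e : nat -> R -> C) (M q : R) F G :
  0 <= q < 1 -> 0 <= M ->
  (forall k, cabs (c k) <= M * q ^+ k) ->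
  (forall k, cmeasurable (e k)) -> (forall k t, cabs (e k t) <= 1) ->
    cintegrable G ->
  (forall t, circ t -> series (fun k => c k * e k t) @ \oo --> F t) ->
  [/\ cmeasurable F, forall t, circ t -> cabs (F t) <= M / (1 - q) &
    series (fun k => c k * cmean (fun t => e k t * G t)) @ \oo -->
      (cmean (fun t => F t * G t) : C)].
Proof.
move=> q01 M0 cq me e1 iG cF.
have iS k : cintegrable (fun t => c k * (e k t * G t)).
  by apply: cintegrableZ; apply: (@cintegrable_bddM _ _ _ 1) => //; exact: ae_circW.
have ms n : cmeasurable (fun t => series (fun k => c k * e k t) n).
  elim: n => [|n IH].
    by rewrite (_ : (fun t => _) = fun=> 0);
      [exact: cmeasurable_cst|apply/funext => t; rewrite /series/= big_nil].
  rewrite (_ : (fun t => _) = fun t =>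
    series (fun k => c k * e k t) n + c n * e n t).
    by apply: cmeasurableD IH _; apply: cmeasurableM;
      [exact: cmeasurable_cst|exact: me].
  by apply/funext => t; rewrite /series/= big_nat_recr.
have bs n t : cabs (series (fun k => c k * e k t) n) <= M / (1 - q).
  rewrite /series/=; apply: le_trans (cabs_sum _ _) _.
  apply: (@le_trans _ _ (\sum_(0 <= k < n) M * q ^+ k)).
    apply: ler_sum => k _; rewrite cabsM; apply: le_trans (cq k).
    by rewrite ler_piMr// cabs_ge0.
  by rewrite -mulr_sumr ler_wpM2l// geom_sum_le.
have mF : cmeasurable F by exact: cmeasurable_cvg ms cF.
have [_ h] : cintegrable (fun t => F t * G t) /\
    (fun n => cmean (fun t => series (fun k => c k * e k t) n * G t)) @ \oo -->
      (cmean (fun t => F t * G t) : C).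
  apply: (@cmean_cvg _ _ _ (fun t => M / (1 - q) * cabs (G t))).
  - by move=> n; apply: cmeasurableM (ms n) (cintegrable_meas iG).
  - exact/rintegrableZ/cintegrable_cabs.
  - by move=> n t _; rewrite cabsM ler_wpM2r ?cabs_ge0.
  - by move=> t ct; apply: cvgMl; exact: cF.
split=> //.
- move=> t ct; have /cvgCP h1 := cF t ct.
  rewrite -subr_le0; apply: (cvgr_to_ge h1); apply: nearW => n.
  rewrite lerBlDr -{1}[F t](subrK (series (fun k => c k * e k t) n)).
  apply: le_trans (cabsD _ _) _.
  by apply: lerD; [rewrite -cabsN opprB|exact: bs].
- apply: cvg_trans h; apply: near_eq_cvg; apply: nearW => n.
  rewrite /series/= big_mkord.
  rewrite (@eq_cmean _ _ (fun t => \sum_(k < n) c k * (e k t * G t))).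
    by rewrite (@cmean_sum _ (fun k t => c k * (e k t * G t)))//;
      apply: eq_bigr => k _; rewrite cmeanZ//;
        apply: (@cintegrable_bddM _ _ _ 1) => //; exact: ae_circW.
  by move=> t _; rewrite big_mkord mulr_suml; apply: eq_bigr => k _; rewrite mulrA.
Qed.

End Quadratic.

(** * Power series on circles inside the disc *)

Section PowerSeries.
Variable R : realType.
Local Notation C := (Cx R).
Local Notation circ := (@circ R).
Implicit Types (F G : R -> C) (h : R -> R) (z w : C) (f : C -> C) (a : nat -> C).

Lemma csum_geom w n : (1 - w) * \sum_(0 <= k < n) w ^+ k = 1 - w ^+ n.
Proof.
elim: n => [|n IH]; first by rewrite big_nil expr0 subrr mulr0.
by rewrite big_nat_recr//= mulrDr IH exprS; ring.
Qed.

Lemma cvg_expC w : cabs w < 1 -> (fun n => w ^+ n) @ \oo --> (0 : C).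
Proof.
move=> w1; apply/cvgCP.
rewrite (_ : (fun n => _) = fun n => cabs w ^+ n); last first.
  by apply/funext => n; rewrite subr0 cabsX.
by apply: cvg_expr; rewrite ger0_norm ?cabs_ge0.
Qed.

Lemma disc_neq1 w : cabs w < 1 -> 1 - w != 0.
Proof.
move=> w1; rewrite subr_eq0; apply: contraTneq w1 => <-.
by rewrite cabs1 ltxx.
Qed.

Lemma cvg_geomC w : cabs w < 1 -> series (fun k => w ^+ k) @ \oo --> (1 - w)^-1.
Proof.
move=> w1; have w0 := disc_neq1 w1.
rewrite (_ : series _ = fun n => (1 - w)^-1 * (1 - w ^+ n)); last first.
  by apply/funext => n; rewrite -csum_geom mulKf.
rewrite -[X in _ --> X]mulr1; apply: cvgMr.
rewrite -[X in _ --> X]subr0; apply: cvgB; first exact: cvg_cst.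
exact: cvg_expC.
Qed.

Lemma cvg_terms_bounded (u : nat -> C) (l : C) : series u @ \oo --> l ->
  exists2 M : R, 0 <= M & forall n, cabs (u n) <= M.
Proof.
move=> ul.
have u0 : u @ \oo --> (0 : C) by apply: (@cvg_series_cvg_0 C C^o); exact: cvgP ul.
move/cvgCP : u0 => /cvgP/cvg_seq_bounded[M [_ /(_ (`|M| + 1))]].
have -> : M < `|M| + 1 by rewrite ltr_pwDr// ler_norm.
move=> /(_ isT) h; exists (`|M| + 1); first by rewrite addr_ge0.
by move=> n; have /= := h n I; rewrite subr0 ger0_norm ?cabs_ge0.
Qed.

(** The sum of an exponential series with geometrically decaying
    coefficients, as the restriction of an analytic function to a circle
    inside the disc is. *)
Definition fourier_geo a F := exists M q : R, [/\ 0 <= q < 1, 0 <= M,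
  forall k, cabs (a k) <= M * q ^+ k &
  forall t, series (fun k => a k * expi t ^+ k) @ \oo --> F t].

Lemma fourier_geo_pair a F G : fourier_geo a F -> cintegrable G ->
  series (fun k => a k * cmean (fun t => expi t ^+ k * G t)) @ \oo -->
    (cmean (fun t => F t * G t) : C).
Proof.
move=> [M [q [q01 M0 aq aF]]] iG.
have me k : cmeasurable (fun t : R => expi t ^+ k : C) by apply: cmeasurableX;
  exact: cmeasurable_expi.
have e1 k (t : R) : cabs (expi t ^+ k : C) <= 1 by rewrite cabs_expiX.
by have [] := cmean_series q01 M0 aq me e1 iG (fun t _ => aF t).
Qed.

Lemma fourier_geo_bdd a F : fourier_geo a F ->
  cmeasurable F /\ exists M, forall t, circ t -> cabs (F t) <= M.
Proof.
move=> [M [q [q01 M0 aq aF]]].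
have me k : cmeasurable (fun t : R => expi t ^+ k : C) by apply: cmeasurableX;
  exact: cmeasurable_expi.
have e1 k (t : R) : cabs (expi t ^+ k : C) <= 1 by rewrite cabs_expiX.
have [mF bF _] :=
  cmean_series q01 M0 aq me e1 (cintegrable_cst 0) (fun t _ => aF t).
by split=> //; exists (M / (1 - q)).
Qed.

Lemma fourier_geo_sqint a F : fourier_geo a F -> sqint F.
Proof.
by move=> /fourier_geo_bdd[mF [M bF]]; apply: (sqint_bdd mF (M := M));
  exact: ae_circW.
Qed.

Lemma cvg_series_delta (u : nat -> C) n (l : C) :
  (forall k, k != n -> u k = 0) -> series u @ \oo --> l -> l = u n.
Proof.
move=> un ul.
have h : series u @ \oo --> u n.
  apply: cvg_near_cst; exists n.+1 => // m /= nm.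
  rewrite /series/= (big_cat_nat (leq0n n.+1) nm)//= big_nat_recr//= big_nat big1
    ?add0r; last first.
    by move=> i /andP[_ ni]; rewrite un// neq_ltn ni.
  rewrite big_nat big1 ?addr0// => i /andP[ni _]; rewrite un// neq_ltn.
  by rewrite ni orbT.
exact: cvg_unique ul h.
Qed.

Lemma fourier_geo_coef a F n : fourier_geo a F ->
  cmean (fun t => F t * (expi t ^+ n)^*) = a n.
Proof.
move=> aF; have :=
  fourier_geo_pair aF (sqint_cintegrable (sqintJ (sqint_expiX _ n))).
move=> /(@cvg_series_delta _ n) ->.
  by rewrite cmean_expi_ortho eqxx mulr1.
by move=> k kn; rewrite cmean_expi_ortho (negbTE kn) mulr0.
Qed.

Lemma fourier_geo_coefN a F n : fourier_geo a F -> (0 < n)%N ->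
  cmean (fun t => F t * expi t ^+ n) = 0 :> C.
Proof.
move=> aF n0; have := fourier_geo_pair aF (sqint_cintegrable (sqint_expiX _ n)).
have e k : cmean (fun t => expi t ^+ k * expi t ^+ n) = 0 :> C.
  by under eq_fun do rewrite -exprD; rewrite cmean_expi// addn_gt0 n0 orbT.
move=> /(@cvg_series_delta _ 0%N) ->; first by rewrite e mulr0.
by move=> k _; rewrite e mulr0.
Qed.

(** Pair F with its own conjugate: the means that appear are the conjugates
    of the coefficients. *)
Lemma fourier_geo_parseval a F : fourier_geo a F ->
  series (fun k => cabs (a k) ^+ 2) @ \oo --> rmean (fun t => cabs (F t) ^+ 2).
Proof.
move=> aF; have cF := fourier_geo_sqint aF.
have := fourier_geo_pair aF (sqint_cintegrable (sqintJ cF)).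
rewrite sqint_norm// => h.
apply/cvgrPdist_lt => e e0.
move/cvgCP/cvgrPdist_lt : h => /(_ e e0); apply: filterS => n.
rewrite sub0r normrN ger0_norm ?cabs_ge0//.
rewrite (_ : series _ n = (series (fun k => cabs (a k) ^+ 2) n)%:C); last first.
  rewrite /series/= (rmorph_sum (real_complex R)); apply: eq_bigr => k _.
  rewrite -[RHS]mulcJ; congr (_ * _); rewrite -(fourier_geo_coef k aF) -cmeanJ.
    by apply: eq_cmean => t _; rewrite cjM cjK mulrC.
  exact: sqint_cintegrableM cF (sqintJ (sqint_expiX _ k)).
have -> x y : (x%:C - y%:C : C) = (x - y)%:C by rewrite (rmorphB (real_complex R)).
by rewrite cabsR distrC.
Qed.

Definition coefs a f := forall z, disc z -> series (fun n => a n * z ^+ n) @ \oo -->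
  f z.

Lemma cabs_rexpi (r t : R) : 0 <= r -> cabs (r%:C * expi t : C) = r.
Proof. by move=> r0; rewrite cabsM cabs_expi mulr1 cabsR ger0_norm. Qed.

(** The terms of the series are bounded on the circle of radius (1 + r) / 2,
    which leaves a geometric factor on the circle of radius r. *)
Lemma coefs_bound a f (r : R) : coefs a f -> 0 <= r < 1 ->
  exists M q : R,
    [/\ 0 <= q < 1, 0 <= M & forall k, cabs (a k) * r ^+ k <= M * q ^+ k].
Proof.
move=> af /andP[r0 r1]; pose p := (1 + r) / 2.
have p1 : p < 1 by rewrite /p; lra.
have p0 : 0 < p by rewrite /p; lra.
have rp : r < p by rewrite /p; lra.
have dp : disc (p%:C : C) by apply/discE; rewrite cabsR ger0_norm// ltW.
have [M M0 hM] := cvg_terms_bounded (af _ dp).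
exists M, (r / p); split => //.
  by rewrite divr_ge0 ?(ltW p0)//= ltr_pdivrMr// mul1r.
move=> k; rewrite exprMn exprVn mulrA -ler_pdivrMr ?invr_gt0 ?exprn_gt0//.
rewrite invrK mulrAC ler_wpM2r ?exprn_ge0//.
by have := hM k; rewrite cabsM cabsX cabsR (ger0_norm (ltW p0)).
Qed.

Lemma coefs_geo a f (r : R) : coefs a f -> 0 <= r < 1 ->
  fourier_geo (fun n => a n * (r ^+ n)%:C) (fun t => f (r%:C * expi t)).
Proof.
move=> af r01; have [M [q [q01 M0 aq]]] := coefs_bound af r01.
have /andP[r0 r1] := r01.
exists M, q; split; [exact: q01|exact: M0| |].
  by move=> k; rewrite cabsM cabsR ger0_norm ?exprn_ge0.
move=> t; have : disc (r%:C * expi t : C) by apply/discE; rewrite cabs_rexpi.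
move=> d; apply: cvg_trans (af _ d); apply: near_eq_cvg; apply: nearW => n.
by rewrite /series/=; apply: eq_bigr => k _; rewrite exprMn -mulrA RCX.
Qed.

Lemma coefs_geoB a f (r s : R) : coefs a f -> 0 <= r -> r <= s -> s < 1 ->
  fourier_geo (fun n => a n * (s ^+ n - r ^+ n)%:C) (fun t =>
    f (s%:C * expi t) - f (r%:C * expi t)).
Proof.
move=> af r0 rs s1; have s01 : 0 <= s < 1 by rewrite (le_trans r0 rs).
have r01 : 0 <= r < 1 by rewrite r0 (le_lt_trans rs).
have [M [q [q01 M0 aq]]] := coefs_bound af s01.
have [_ [_ [_ _ _ hr]]] := coefs_geo af r01.
have [_ [_ [_ _ _ hs]]] := coefs_geo af s01.
exists M, q; split; [exact: q01|exact: M0| |].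
  move=> k; rewrite cabsM cabsR; apply: le_trans (aq k).
  have rk : r ^+ k <= s ^+ k by rewrite lerXn2r// nnegrE ?(le_trans r0 rs).
  rewrite ler_wpM2l ?cabs_ge0// ger0_norm ?subr_ge0//.
  by rewrite gerBl exprn_ge0.
move=> t; apply: cvg_trans (cvgB (hs t) (hr t)).
apply: near_eq_cvg; apply: nearW => n.
rewrite fctE /series/= -sumrB; apply: eq_bigr => k _.
by rewrite (rmorphB (real_complex R)) mulrBr mulrBl.
Qed.

(** By Parseval this is (s^k - r^k)^2 <= s^2k - r^2k for every k. Bounded
    means thus make the dilates of f a Cauchy family in mean square. *)
Lemma mean_diff_le a f (r s : R) : coefs a f -> 0 <= r -> r <= s -> s < 1 ->
  rmean (fun t => cabs (f (s%:C * expi t) - f (r%:C * expi t)) ^+ 2) <=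
  rmean (fun t => cabs (f (s%:C * expi t)) ^+ 2) -
    rmean (fun t => cabs (f (r%:C * expi t)) ^+ 2).
Proof.
move=> af r0 rs s1; have s0 := le_trans r0 rs.
have s01 : 0 <= s < 1 by rewrite s0.
have r01 : 0 <= r < 1 by rewrite r0 (le_lt_trans rs).
apply: (ler_cvg_to (fourier_geo_parseval (coefs_geoB af r0 rs s1))
  (cvgB (fourier_geo_parseval (coefs_geo af s01))
    (fourier_geo_parseval (coefs_geo af r01)))).
apply: nearW => n; rewrite /= fctE /series/= -sumrB; apply: ler_sum => k _.
rewrite !cabsM !exprMn !cabsR -mulrBr ler_wpM2l ?sqr_ge0//.
rewrite !real_normK ?num_real//.
have : r ^+ k <= s ^+ k by rewrite lerXn2r// nnegrE.
have := exprn_ge0 k r0; nra.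
Qed.

End PowerSeries.

(** * Mean-square convergence to the boundary function *)

Section Boundary.
Variable R : realType.
Local Notation C := (Cx R).
Local Notation mu := (@lebesgue_measure R).
Local Notation circ := (@circ R).
Implicit Types (F : R -> C) (g h : R -> R) (f : C -> C) (a : nat -> C).

Hint Resolve measurable_circ : core.

(** The convergence theorems for integrals concern sequences, so limits at
    the boundary are taken along these radii. *)
Definition radius k : R := 1 - k.+1%:R^-1.

Lemma radius01 k : 0 <= radius k < 1.
Proof.
rewrite /radius subr_ge0 invf_le1 ?ltr0n// ler1n /= ltrBlDr ltrDl.
by rewrite invr_gt0 ltr0n.
Qed.

Lemma radius_nd j k : (j <= k)%N -> radius j <= radius k.
Proof. by move=> jk; rewrite /radius lerB// lef_pV2 ?posrE ?ltr0n// ler_nat. Qed.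

Lemma radius_cvg : radius @ \oo --> (1 : R).
Proof.
rewrite -[X in _ --> X]subr0; apply: cvgB; first exact: cvg_cst.
exact: cvg_harmonic.
Qed.

Lemma radius_left : radius @ \oo --> (1 : R)^'-.
Proof.
move=> P h.
have h1 : \forall k \near \oo, radius k < 1 -> P (radius k).
  exact: (radius_cvg (h : nbhs (1 : R) (fun x => x < 1 -> P x))).
have h2 : \forall k \near \oo, P (radius k).
  by apply: filterS h1 => k; apply; have /andP[] := radius01 k.
exact: h2.
Qed.

Lemma int_rmean h : rintegrable h ->
  (\int[mu]_(t in circ) (h t)%:E = ((2 * pi) * rmean h)%:E)%E.
Proof.
move=> ih; rewrite /rmean mulVKf ?gt_eqF ?circ_pi// fineK//.
exact: (@integrable_fin_num _ _ _ mu circ (@measurable_circ R) (EFin \o h) ih).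
Qed.

Lemma sqint_L2T f : sqint (fun t => f (expi t)) <-> L2T f.
Proof.
have e : (\int[mu]_(t in circ) `|(EFin \o (fun t => (cabs (f (expi t)) ^+ 2)%R)) t|
  =
    \int[mu]_(t in circ) (cabs (f (expi t)) ^+ 2)%:E)%E.
  by apply: eq_integral => t _ /=; rewrite ger0_norm// sqr_ge0.
split=> [[mf /integrableP[_ i]]|[mf i]]; split => //.
  by move: i; rewrite e.
apply/integrableP; split; first by apply/measurable_EFinP;
  exact: rmeasurable_cabs2 mf.
by rewrite e.
Qed.

Lemma limn_einf_le (u : nat -> \bar R) (c : \bar R) k :
  (forall j, (k <= j)%N -> (u j <= c)%E) -> (limn_einf u <= c)%E.
Proof.
move=> uc; rewrite limn_einf_lim; apply: lime_le; first exact: is_cvg_einfs.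
apply: nearW => n; apply: (@le_trans _ _ (u (maxn n k))).
  by apply: ereal_inf_lbound; exists (maxn n k) => //=; rewrite leq_maxl.
by apply: uc; rewrite leq_maxr.
Qed.

Lemma limn_einf_nneg (u : nat -> \bar R) : (forall j, (0 <= u j)%E) ->
  (0 <= limn_einf u)%E.
Proof.
move=> u0; rewrite limn_einf_lim; apply: lime_ge; first exact: is_cvg_einfs.
by apply: nearW => n; apply: le_ereal_inf_tmp => _ [j _ <-].
Qed.

(** The squared means m of the dilates increase to a finite limit L, and
    [mean_diff_le] bounds the distance of two of them. Letting one radius
    tend to 1, Fatou's lemma bounds the squared distance from the k-th
    dilate to the boundary function by L - m k. *)
Lemma H2_mean_square_cvg f : H2 f ->
  (fun k => rmean (fun t => cabs (f ((radius k)%:C * expi t) - f (expi t)) ^+ 2)) @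
    \oo --> (0 : R).
Proof.
move=> [[a af] [M fM] /sqint_L2T cf rf].
pose F k t := f ((radius k)%:C * expi t).
have gF k : fourier_geo (fun n => a n * (radius k ^+ n)%:C) (F k)
  by apply: coefs_geo af (radius01 k).
have cF k : sqint (F k) by exact: fourier_geo_sqint (gF k).
pose m k := rmean (fun t => cabs (F k t) ^+ 2).
have dm j k : (j <= k)%N -> rmean (fun t => cabs (F k t - F j t) ^+ 2) <= m k - m j.
  move=> jk; have /andP[r0 _] := radius01 j; have /andP[_ s1] := radius01 k.
  exact: mean_diff_le af r0 (radius_nd jk) s1.
have ndm : nondecreasing_seq m.
  move=> j k jk; rewrite -subr_ge0; apply: le_trans (dm _ _ jk).
  by apply: rmean_ge0 => t _; exact: sqr_ge0.
have mM : has_ubound (range m).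
  exists ((2 * pi)^-1 * M) => _ [k _ <-].
  rewrite ler_pdivlMl ?circ_pi//; rewrite -lee_fin -int_rmean; last by have [] :=
    cF k.
  exact: fM (radius01 k).
have mL := nondecreasing_cvgn ndm mM; set L := sup _ in mL.
have mleL k : m k <= L by apply: ub_le_sup => //; exists k.
suff key k : rmean (fun t => cabs (F k t - f (expi t)) ^+ 2) <= L - m k.
  apply: (@squeeze_cvgr _ _ _ _ (cst 0) (fun k => L - m k)).
  - by apply: nearW => k; rewrite key rmean_ge0// => t _; exact: sqr_ge0.
  - exact: cvg_cst.
  - by rewrite -[X in _ --> X](subrr L); apply: cvgB => //; exact: cvg_cst.
pose g j t := (cabs (F j t - F k t) ^+ 2)%:E.
have mg j : measurable_fun circ (g j).
  by apply/measurable_EFinP; apply: rmeasurable_cabs2; have [] :=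
    sqintB (cF j) (cF k).
have g0 j t : circ t -> (0 <= g j t)%E by move=> _; rewrite lee_fin sqr_ge0.
have := fatou mu (@measurable_circ R) mg g0.
have cD := sqintB (cF k) cf.
rewrite -(@ge0_ae_eq_integral _ _ _ mu circ (fun t =>
  (cabs (F k t - f (expi t)) ^+ 2)%:E)); first last.
- apply: (@filterS _ _ (@ae_lebesgue_filter R) _ _ _ rf) => t ht ct; apply/esym.
  have h : g ^~ t @ \oo --> (cabs (F k t - f (expi t)) ^+ 2)%:E.
    apply: cvg_EFin; first exact: nearW.
    apply: (@cvg_comp _ _ _ (fun j => cabs (F j t - F k t)) (fun x => x ^+ 2) _
      (nbhs (cabs (F k t - f (expi t))))); last first.
      exact: exprn_continuous.
    have /cvgCP hf : (fun j => F j t) @ \oo --> f (expi t).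
      exact: (cvg_comp _ _ radius_left (ht ct)).
    apply/cvgrPdist_le => e e0.
    move/cvgrPdist_le : hf => /(_ e e0); apply: filterS => j.
    rewrite sub0r normrN ger0_norm ?cabs_ge0//; apply: le_trans.
    rewrite -[cabs (F k t - _)]cabsN opprB; apply: le_trans (cabs_dist _ _) _.
    by rewrite -cabsN !opprB addrA subrK.
  by have [] := cvg_limn_einf_sup h.
- by move=> t ct; apply: limn_einf_nneg => j; exact: g0.
- by move=> t _; rewrite lee_fin sqr_ge0.
- rewrite /limn_einf; apply: measurableT_comp => //.
  apply: measurable_fun_limn_esup => j.
  by apply: measurableT_comp => //; exact: mg.
- by apply/measurable_EFinP; apply: rmeasurable_cabs2; have [] := cD.
- exact: measurable_circ.
move=> /le_trans => /(_ ((2 * pi) * (L - m k))%:E).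
rewrite int_rmean; last by have [] := cD.
rewrite lee_fin ler_pM2l ?circ_pi//; apply.
apply: (@limn_einf_le _ _ k) => j kj.
rewrite /g int_rmean; last by have [] := sqintB (cF j) (cF k).
rewrite lee_fin ler_pM2l ?circ_pi//; apply: le_trans (dm _ _ kj) _.
by rewrite lerD2r.
Qed.

End Boundary.

(** * Cauchy integrals and the Hardy space *)

Section Reproducing.
Variable R : realType.
Local Notation C := (Cx R).
Local Notation Re := (@complex.Re R).
Local Notation circ := (@circ R).
Implicit Types (G : R -> C) (h : R -> R) (z : C) (f : C -> C) (a : nat -> C).

(** On the circle this is the conjugate of the reproducing kernel of H^2 at
    z. *)
Definition cauchy_ker z t : C := (1 - z * (expi t)^*)^-1.

Lemma cauchy_ker_neq0 z (t : R) : cabs z < 1 -> 1 - z * (expi t)^* != 0 :> C.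
Proof. by move=> z1; apply: disc_neq1; rewrite cabsM cabsJ cabs_expi mulr1. Qed.

Lemma cabs_1B z : 1 - cabs z <= cabs (1 - z).
Proof.
by rewrite -[X in X - _](@cabs1 R); apply: le_trans (cabs_dist _ _);
  exact: ler_norm.
Qed.

Lemma cmeasurable_cauchy_ker z : cmeasurable (cauchy_ker z).
Proof.
apply: cmeasurableV; apply: cmeasurableB; first exact: cmeasurable_cst.
by apply: cmeasurableM;
  [exact: cmeasurable_cst|exact: cmeasurableJ (@cmeasurable_expi R)].
Qed.

Lemma cauchy_ker_bound z t : cabs z < 1 -> cabs (cauchy_ker z t) <= (1 - cabs z)^-1.
Proof.
move=> z1; have z0 : 0 < 1 - cabs z by rewrite subr_gt0.
have h : 1 - cabs z <= cabs (1 - z * (expi t)^*).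
  by have := cabs_1B (z * (expi t)^*); rewrite cabsM cabsJ cabs_expi mulr1.
by rewrite cabsV lef_pV2// posrE (lt_le_trans z0 h).
Qed.

Lemma cauchy_ker_sqint z : cabs z < 1 -> sqint (cauchy_ker z).
Proof.
move=> z1; apply: (sqint_bdd (cmeasurable_cauchy_ker z) (M := (1 - cabs z)^-1)).
by apply: ae_circW => t _; exact: cauchy_ker_bound.
Qed.

Lemma cauchy_ker_cintegrable z G : cabs z < 1 -> cintegrable G ->
  cintegrable (fun t => cauchy_ker z t * G t).
Proof.
move=> z1 iG;
  apply: (cintegrable_bddM (cmeasurable_cauchy_ker z) (M := (1 - cabs z)^-1)) => //.
by apply: ae_circW => t _; exact: cauchy_ker_bound.
Qed.

Lemma cauchy_series z G : disc z -> cintegrable G ->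
  series (fun k => cmean (fun t => ((expi t)^*) ^+ k * G t) * z ^+ k) @ \oo -->
  (cmean (fun t => cauchy_ker z t * G t) : C).
Proof.
move=> /discE z1 iG.
have q01 : 0 <= cabs z < 1 by rewrite cabs_ge0.
have cq k : cabs (z ^+ k) <= 1 * cabs z ^+ k by rewrite mul1r cabsX.
have me k : cmeasurable (fun t : R => ((expi t)^*) ^+ k : C).
  by apply: cmeasurableX; exact: cmeasurableJ (@cmeasurable_expi R).
have e1 k (t : R) : cabs (((expi t)^*) ^+ k : C) <= 1
  by rewrite cabsX cabsJ cabs_expi expr1n.
have cF t : circ t -> series (fun k => z ^+ k * ((expi t)^*) ^+ k) @ \oo -->
  cauchy_ker z t.
  move=> _; under [series _]eq_fun do under eq_bigr do rewrite -exprMn.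
  by apply: cvg_geomC; rewrite cabsM cabsJ cabs_expi mulr1.
have [_ _] := cmean_series q01 ler01 cq me e1 iG cF.
apply: cvg_trans; apply: near_eq_cvg; apply: nearW => n.
by rewrite /series/=; apply: eq_bigr => k _; rewrite mulrC.
Qed.

Lemma H2_sqint f : H2 f -> sqint (fun t => f (expi t)).
Proof. by case=> _ _ /sqint_L2T. Qed.

Lemma H2_pair_cvg f G : H2 f -> sqint G ->
  (fun k => cmean (fun t => f ((radius R k)%:C * expi t) * G t)) @ \oo -->
  (cmean (fun t => f (expi t) * G t) : C).
Proof.
move=> hf cG; apply: sqint_cvg => //.
- by move=> k; have [[a af] _ _ _] := hf;
    apply: fourier_geo_sqint (coefs_geo af (radius01 R k)).
- exact: H2_sqint.
- exact: H2_mean_square_cvg.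
Qed.

Lemma H2_coef f a n : H2 f -> coefs a f ->
  cmean (fun t => ((expi t)^*) ^+ n * f (expi t)) = a n.
Proof.
move=> hf af.
have h := H2_pair_cvg hf (sqintJ (sqint_expiX R n)).
rewrite (@eq_cmean _ _ (fun t => f (expi t) * (expi t ^+ n)^*)); last first.
  by move=> t _; rewrite cjX mulrC.
suff h2 : (fun k => cmean (fun t => f ((radius R k)%:C * expi t) * (expi t ^+ n)^*))
  @ \oo --> a n.
  exact: cvg_unique h h2.
have e k : cmean (fun t => f ((radius R k)%:C * expi t) * (expi t ^+ n)^*) = a n *
  (radius R k ^+ n)%:C.
  by rewrite (fourier_geo_coef n (coefs_geo af (radius01 R k))).
rewrite (_ : (fun k => _) = fun k => a n * (radius R k ^+ n)%:C); last exact/funext.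
rewrite -[X in _ --> X]mulr1; apply: cvgMr.
apply/cvgCP.
have r1 : (fun k => radius R k ^+ n) @ \oo --> (1 : R).
  rewrite -[X in _ --> X](expr1n R n).
  apply: (@cvg_comp _ _ _ (radius R) (fun x => x ^+ n) _ (nbhs (1 : R)));
    first exact: radius_cvg.
  exact: exprn_continuous.
apply/cvgrPdist_lt => eps eps0.
move/cvgrPdist_lt : r1 => /(_ eps eps0); apply: filterS => k.
rewrite -(rmorph1 (real_complex R)) -(rmorphB (real_complex R)) cabsR sub0r normrN
  normr_id.
by rewrite distrC.
Qed.

(** Expanding the Cauchy kernel gives the power series whose coefficients
    are the Fourier coefficients of the boundary function, and these are the
    Taylor coefficients by [H2_coef]. *)
Lemma H2_repr f z : H2 f -> disc z ->
  f z = cmean (fun t => cauchy_ker z t * f (expi t)).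
Proof.
move=> hf dz; have [[a af] _ _ _] := hf.
have := cauchy_series dz (sqint_cintegrable (H2_sqint hf)).
under [X in series X]eq_fun do rewrite (H2_coef _ hf af).
by move=> h; exact: cvg_unique (af z dz) h.
Qed.

Lemma H2_neg f n : H2 f -> (0 < n)%N ->
  cmean (fun t => expi t ^+ n * f (expi t)) = 0.
Proof.
move=> hf n0; have [[a af] _ _ _] := hf.
have h := H2_pair_cvg hf (sqint_expiX R n).
rewrite (@eq_cmean _ _ (fun t => f (expi t) * expi t ^+ n)); last by move=> t _;
  rewrite mulrC.
suff h2 : (fun k => cmean (fun t => f ((radius R k)%:C * expi t) * expi t ^+ n)) @
  \oo --> (0 : C).
  exact: cvg_unique h h2.
rewrite (_ : (fun k => _) = fun=> 0); first exact: cvg_cst.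
by apply/funext => k; exact: fourier_geo_coefN (coefs_geo af (radius01 R k)) n0.
Qed.

(** Converse of [H2_repr], through which every membership in H^2 below is
    shown. Analyticity is the expansion of the Cauchy kernel. For the means,
    mean (f_r conj f) is the sum of the |a_k|^2 r^k, hence at least mean
    |f_r|^2, and 0 <= mean |f - f_r|^2 then gives mean |f_r|^2 <= mean
    |f|^2. *)
Lemma H2_of_repr f : L2T f ->
  (forall z, disc z -> f z = cmean (fun t => cauchy_ker z t * f (expi t))) ->
  aeT (fun z => (fun r : R => f (r%:C * z)) @ 1^'- --> f z) -> H2 f.
Proof.
move=> lf rep frad; have /sqint_L2T cf := lf.
pose a n : C := cmean (fun t => ((expi t)^*) ^+ n * f (expi t)).
have af : coefs a f.
  by move=> z dz; rewrite (rep z dz);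
    exact: cauchy_series dz (sqint_cintegrable cf).
split => //; first by exists a; exact: af.
exists ((2 * pi) * rmean (fun t => cabs (f (expi t)) ^+ 2)) => r r01.
have gr := coefs_geo af r01; have cr := fourier_geo_sqint gr.
rewrite int_rmean; last by have [] := cr.
rewrite lee_fin ler_pM2l ?circ_pi//.
set m := rmean _; set M := rmean _.
have h1 := fourier_geo_parseval gr.
have h2 := fourier_geo_pair gr (sqint_cintegrable (sqintJ cf)).
set I : C := cmean _ in h2.
have c0 := sqintB cf cr.
have : 0 <= rmean (fun t => cabs (f (expi t) - f (r%:C * expi t)) ^+ 2).
  by apply: rmean_ge0 => t _; exact: sqr_ge0.
have -> : rmean (fun t => cabs (f (expi t) - f (r%:C * expi t)) ^+ 2) = M - 2 *
  Re I + m.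
  have [_ iM] := cf; have [_ im] := cr.
  have iI := sqint_cintegrableM cr (sqintJ cf); have [iRI _] := iI.
  rewrite /I Re_cmean -(rmeanZ 2 iRI) -mulN1r -rmeanZ; last exact: rintegrableZ.
  rewrite /M -rmeanD//; last by do 2 apply: rintegrableZ.
  rewrite /m -rmeanD//; last by apply: rintegrableD => //; do 2 apply: rintegrableZ.
  apply: eq_rmean => t _ /=; rewrite !cabs_sqr.
  case: (f (expi t)) => x y; case: (f _) => u v /=; ring.
suff : m <= Re I by move=> h3 h4; lra.
have hI : (fun n =>
  Re (series (fun k =>
    a k * (r ^+ k)%:C * cmean (fun t => expi t ^+ k * (f (expi t))^*)) n)) @ \oo -->
      Re I.
  move/cvgCP : h2 => h2; apply/cvgrPdist_le => e e0.
  move/cvgrPdist_le : h2 => /(_ e e0); apply: filterS => n.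
  rewrite sub0r normrN ger0_norm ?cabs_ge0//; apply: le_trans.
  by rewrite distrC -cReN -cReD; exact: Re_le_cabs.
apply: (ler_cvg_to h1 hI); apply: nearW => n.
have Re_sum (u : nat -> C) : Re (series u n) = series (fun k => Re (u k)) n.
  rewrite /series/=; elim: n => [|n IH]; first by rewrite !big_nil.
  by rewrite !big_nat_recr//= -IH cReD.
rewrite Re_sum; apply: ler_sum => k _.
have /andP[r0 r1] := r01.
have -> : cmean (fun t => expi t ^+ k * (f (expi t))^*) = (a k)^* :> C.
  rewrite /a -cmeanJ; last first.
    apply: sqint_cintegrable; apply: (sqint_bddM (M := 1) _ _ cf).
      by apply: cmeasurableX; exact: cmeasurableJ (@cmeasurable_expi R).
    by apply: ae_circW => t _; rewrite cabsX cabsJ cabs_expi expr1n.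
  by apply: eq_cmean => t _; rewrite cjM cjX cjK.
have ReC (x : R) : Re (x%:C : C) = x by [].
rewrite mulrAC mulcJ -RCM ReC cabsM cabsR exprMn real_normK ?num_real//.
rewrite ler_wpM2l ?sqr_ge0// expr2 ler_piMl ?exprn_ge0//.
by rewrite exprn_ile1 ?(ltW r1).
Qed.

End Reproducing.

(** * Products in the Hardy space *)

Section Closure.
Variable R : realType.
Local Notation C := (Cx R).
Implicit Types (G : R -> C) (h : R -> R) (z w : C) (f u theta : C -> C)
  (a : nat -> C).

Lemma H2_radial f : H2 f ->
  aeT (fun z => (fun r : R => f (r%:C * z)) @ 1^'- --> f z).
Proof. by case. Qed.

Lemma cvg_rC z : (fun r : R => r%:C * z : C) @ (1 : R)^'- --> z.
Proof.
apply/cvgCP; rewrite (_ : (fun t => _) = fun r => `|r - 1| * cabs z); last first.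
  apply/funext => r; rewrite -{2}[z]mul1r -mulrBl cabsM; congr (_ * _).
  by rewrite -(rmorph1 (real_complex R)) -(rmorphB (real_complex R)) cabsR.
rewrite -[X in _ --> X](mul0r (cabs z)); apply: cvgMl.
rewrite -[X in _ --> X](normr0 R); apply: cvg_norm.
rewrite -[X in _ --> X](subrr (1:R)); apply: cvgB; last exact: cvg_cst.
exact: cvg_at_left_filter.
Qed.

Lemma cexpi_le (t : R) : cabs (expi t : C) <= 1. Proof. by rewrite cabs_expi. Qed.

Lemma H2_ext f u : (forall z, cabs z <= 1 -> f z = u z) -> H2 f -> H2 u.
Proof.
move=> fu hf.
have e : (fun t => u (expi t)) = (fun t => f (expi t)).
  by apply/funext => t; rewrite fu// cexpi_le.
apply: H2_of_repr.
- by apply/sqint_L2T; rewrite e; exact: H2_sqint.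
- move=> z dz; rewrite -fu; last by apply: ltW; exact/discE.
  by rewrite (H2_repr hf dz); apply: eq_cmean => t _; rewrite fu// cexpi_le.
- apply: ae_circS (H2_radial hf) => t _ h; rewrite -fu ?cexpi_le//.
  apply: cvg_trans h; apply: near_eq_cvg.
  near=> r; apply: fu; rewrite cabsM cabs_expi mulr1 cabsR ger0_norm.
    by near: r; exact: nbhs_left_le.
  by near: r; apply: nbhs_left_ge.
Unshelve. all: by end_near. Qed.

Lemma H2D f u : H2 f -> H2 u -> H2 (fun z => f z + u z).
Proof.
move=> hf hu; have cf := H2_sqint hf; have cu := H2_sqint hu; apply: H2_of_repr.
- by apply/sqint_L2T; exact: sqintD cf cu.
- move=> z dz; rewrite (H2_repr hf dz) (H2_repr hu dz) -cmeanD; last 2 first.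
  + by apply: cauchy_ker_cintegrable (sqint_cintegrable cf); exact/discE.
  + by apply: cauchy_ker_cintegrable (sqint_cintegrable cu); exact/discE.
  by apply: eq_cmean => t _; rewrite mulrDr.
- apply: ae_circS2 (H2_radial hf) (H2_radial hu) => t _ h1 h2; exact: cvgD h1 h2.
Qed.

Lemma H2Z (c : C) f : H2 f -> H2 (fun z => c * f z).
Proof.
move=> hf; have cf := H2_sqint hf; apply: H2_of_repr.
- by apply/sqint_L2T; exact: sqintZ cf.
- move=> z dz; rewrite (H2_repr hf dz) -cmeanZ; last first.
    by apply: cauchy_ker_cintegrable (sqint_cintegrable cf); exact/discE.
  by apply: eq_cmean => t _; rewrite mulrCA.
- by apply: ae_circS (H2_radial hf) => t _ h; exact: cvgMr h.
Qed.

Lemma H2_cst (c : C) : H2 (fun=> c).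
Proof.
apply: H2_of_repr.
- by apply/sqint_L2T; exact: sqint_cst.
- move=> z dz; have := cauchy_series dz (cintegrable_cst c).
  move=> /(@cvg_series_delta _ _ 0%N) ->.
    by rewrite expr0 mulr1 -[LHS]cmean_cst; apply: eq_cmean => t _;
      rewrite expr0 mul1r.
  move=> k k0;
    rewrite (@eq_cmean _ _ (fun t => c * (expi t ^+ k * (expi t ^+ 0)^*)^*));
      last first.
    by move=> t _; rewrite expr0 cj1 mulr1 cjX mulrC.
  rewrite cmeanZ; last by apply: cintegrableJ;
    apply: sqint_cintegrableM (sqint_expiX _ _) (sqintJ (sqint_expiX _ _)).
  rewrite cmeanJ;
    last by apply: sqint_cintegrableM (sqint_expiX _ _) (sqintJ (sqint_expiX _ _)).
  by rewrite cmean_expi_ortho (negbTE k0) cj0 mulr0 mul0r.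
- by apply: ae_circW => t _; exact: cvg_cst.
Qed.

Lemma H2N f : H2 f -> H2 (fun z => - f z).
Proof. by move=> hf; apply: H2_ext (H2Z (-1) hf) => z _; rewrite mulN1r. Qed.

Lemma H2B f u : H2 f -> H2 u -> H2 (fun z => f z - u z).
Proof. by move=> hf hu; exact: H2D hf (H2N hu). Qed.

(** On the circle e^(it) cauchy_ker = e^(it) + z cauchy_ker, and e^(it) f
    has mean 0 by [H2_neg]. *)
Lemma H2_mulz f : H2 f -> H2 (fun z => z * f z).
Proof.
move=> hf; have cf := H2_sqint hf.
have cef : sqint (fun t => expi t * f (expi t)).
  by apply: (sqint_bddM (M := 1) (@cmeasurable_expi R) _ cf);
    apply: ae_circW => t _; exact: cexpi_le.
apply: H2_of_repr.
- exact/sqint_L2T.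
- move=> z dz; have z1 : cabs z < 1 by exact/discE.
  rewrite (H2_repr hf dz) -cmeanZ;
    last exact: cauchy_ker_cintegrable (sqint_cintegrable cf).
  rewrite -[LHS]addr0 -(H2_neg hf (n := 1))// -cmeanD.
  + apply: eq_cmean => t _; rewrite expr1.
    have : (1 - z * (expi t)^*) * cauchy_ker z t = 1
      by rewrite mulfV// cauchy_ker_neq0.
    move=> h; have key : expi t = cauchy_ker z t * expi t - z * cauchy_ker z t :> C.
      transitivity
        (cauchy_ker z t * expi t - z * cauchy_ker z t * (expi t * (expi t)^*));
          last by rewrite expiJ mulr1.
      by rewrite -[LHS]mul1r -h; ring.
    by rewrite [X in _ + X * _]key; ring.
  + by apply: cintegrableZ; apply: cauchy_ker_cintegrable (sqint_cintegrable cf).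
  + by apply: eq_cintegrable (sqint_cintegrable cef) => t _; rewrite expr1.
- by apply: ae_circS (H2_radial hf) => t _ h; exact: (cvgM (@cvg_rC (expi t)) h).
Qed.

Lemma H2_mulX f n : H2 f -> H2 (fun z => z ^+ n * f z).
Proof.
move=> hf; elim: n => [|n IH]; first by apply: H2_ext hf => z _;
  rewrite expr0 mul1r.
by apply: H2_ext (H2_mulz IH) => z _; rewrite exprS mulrA.
Qed.

(** This identity gives both the continuity of Cauchy integrals in z and, in
    [H2_k_tilde], the division by z - lam. *)
Lemma cauchy_kerB z w t : cabs z < 1 -> cabs w < 1 ->
  cauchy_ker z t - cauchy_ker w t = (z - w) *
    ((expi t)^* * cauchy_ker z t * cauchy_ker w t).
Proof.
move=> z1 w1; rewrite /cauchy_ker; field.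
by rewrite -[1 - z * _]/(1 - z * (expi t)^*) !cauchy_ker_neq0.
Qed.

Lemma cauchy_cvg (T : Type) (FF : set_system T) {FFF : Filter FF} (v : T -> C)
  (l : C) G :
  cintegrable G -> disc l -> v @ FF --> l ->
  (fun x => cmean (fun t => cauchy_ker (v x) t * G t)) @ FF -->
    (cmean (fun t => cauchy_ker l t * G t) : C).
Proof.
move=> iG /discE l1 vl.
pose s := (1 - cabs l) / 2; have s0 : 0 < s by rewrite divr_gt0// subr_gt0.
pose K := s^-1 ^+ 2 * rmean (fun t => cabs (G t)).
move/cvgCP : vl => vl; apply/cvgCP.
apply: (@squeeze_cvgr _ _ _ _ (cst 0) (fun x => cabs (v x - l) * K)).
- move/cvgrPdist_lt : (vl) => /(_ s s0); apply: filterS => x.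
  rewrite sub0r normrN ger0_norm ?cabs_ge0// => vs.
  have vx1 : cabs (v x) <= 1 - s.
    have := cabsD (v x - l) l; rewrite subrK; move: vs; rewrite /s; lra.
  have v1 : cabs (v x) < 1 by apply: le_lt_trans vx1 _; rewrite ltrBlDr ltrDl.
  rewrite andTb -cmeanB; try exact: cauchy_ker_cintegrable.
  rewrite (@eq_cmean _ _ (fun t =>
    (v x - l) * ((expi t)^* * cauchy_ker (v x) t * cauchy_ker l t * G t)));
      last first.
    by move=> t _; rewrite -mulrBl cauchy_kerB// !mulrA.
  have b t : cabs ((expi t)^* * cauchy_ker (v x) t * cauchy_ker l t : C) <=
    s^-1 ^+ 2.
    rewrite !cabsM cabsJ cabs_expi mul1r expr2.
    apply: ler_pM; rewrite ?cabs_ge0//;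
      apply: le_trans (cauchy_ker_bound _ _) _ => //;
      rewrite lef_pV2 ?posrE ?subr_gt0//.
      by rewrite lerBrDr addrC -lerBrDr.
    by rewrite /s; lra.
  have me : cmeasurable
    (fun t : R => (expi t)^* * cauchy_ker (v x) t * cauchy_ker l t : C).
    by apply: cmeasurableM (cmeasurable_cauchy_ker _);
      apply: cmeasurableM (cmeasurable_cauchy_ker _);
        exact: cmeasurableJ (@cmeasurable_expi R).
  have iE := cintegrable_bddM me (ae_circW (fun t _ => b t)) iG.
  rewrite cmeanZ// cabsM ler_wpM2l ?cabs_ge0// /K -rmeanZ;
    last exact: cintegrable_cabs.
  apply: cmean_le_ae => //; first by apply: rintegrableZ; exact: cintegrable_cabs.
  by apply: ae_circW => t _; rewrite cabsM ler_wpM2r ?cabs_ge0.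
- exact: cvg_cst.
- by rewrite -[X in _ --> X](mul0r K); apply: cvgMl.
Qed.

Lemma H2_cvg (T : Type) (FF : set_system T) {FFF : Filter FF} (v : T -> C)
  (l : C) f :
  H2 f -> disc l -> (\forall x \near FF, disc (v x)) -> v @ FF --> l ->
  (fun x => f (v x)) @ FF --> f l.
Proof.
move=> hf dl dv vl; rewrite (H2_repr hf dl).
apply: cvg_trans (cauchy_cvg (sqint_cintegrable (H2_sqint hf)) dl vl).
by apply: near_eq_cvg; apply: filterS dv => x dx; rewrite -H2_repr.
Qed.

Lemma Hinf_ae theta M : H2 theta -> (forall z, disc z -> cabs (theta z) <= M) ->
  aeT (fun z => cabs (theta z) <= M).
Proof.
move=> ht hM; apply: ae_circS (H2_radial ht) => t _ h.
have {}h : (fun k => theta ((radius R k)%:C * expi t)) @ \oo --> theta (expi t).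
  exact: (cvg_comp _ _ (@radius_left R) h).
move/cvgCP : h => h; rewrite -subr_le0; apply: (cvgr_to_ge h); apply: nearW => k.
have /andP[r0 r1] := radius01 R k.
have dk : disc ((radius R k)%:C * expi t : C) by apply/discE; rewrite cabs_rexpi.
rewrite lerBlDr -{1}[theta (expi t)](subrK (theta ((radius R k)%:C * expi t))).
apply: le_trans (cabsD _ _) _.
by apply: lerD; [rewrite -cabsN opprB|exact: hM].
Qed.

(** For a dilate of theta, expand theta in powers of e^(it): by [H2_mulX]
    the n-th power leaves the Cauchy integral of f as z^n, and the sum is
    theta (r z) f z. Then r tends to 1. *)
Lemma H2_mul theta f : Hinf theta -> H2 f -> H2 (fun z => theta z * f z).
Proof.
move=> [ht [M hM]] hf; have cf := H2_sqint hf; have [mt _] := H2_sqint ht.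
have bt := Hinf_ae ht hM.
apply: H2_of_repr.
- by apply/sqint_L2T; exact: sqint_bddM mt bt cf.
- move=> z dz; have z1 : cabs z < 1 by exact/discE.
  have cG : sqint (fun t => cauchy_ker z t * f (expi t)).
    apply: (sqint_bddM (M := (1 - cabs z)^-1) (cmeasurable_cauchy_ker z) _ cf).
    by apply: ae_circW => t _; exact: cauchy_ker_bound.
  have h1 := H2_pair_cvg ht cG.
  have [[a at_] _ _ _] := ht.
  have e k : cmean (fun t =>
    theta ((radius R k)%:C * expi t) * (cauchy_ker z t * f (expi t))) =
      theta ((radius R k)%:C * z) * f z.
    have := fourier_geo_pair (coefs_geo at_ (radius01 R k)) (sqint_cintegrable cG).
    have e2 n : cmean (fun t => expi t ^+ n * (cauchy_ker z t * f (expi t))) =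
      z ^+ n * f z.
      rewrite (H2_repr (H2_mulX n hf) dz); apply: eq_cmean => t _; exact: mulrCA.
    under [X in series X]eq_fun do rewrite e2.
    move=> h; suff h' : series (fun n =>
      a n * (radius R k ^+ n)%:C * (z ^+ n * f z)) @ \oo -->
        theta ((radius R k)%:C * z) * f z.
      exact: cvg_unique h h'.
    have dk : disc ((radius R k)%:C * z).
      apply/discE; have /andP[r0 r1] := radius01 R k.
      rewrite cabsM cabsR ger0_norm//; apply: le_lt_trans z1.
      by rewrite ler_piMl ?cabs_ge0// ltW.
    rewrite (_ : series _ = fun n =>
      series (fun k0 => a k0 * ((radius R k)%:C * z) ^+ k0) n * f z).
      by apply: cvgMl; exact: at_.
    apply/funext => n; rewrite /series/= mulr_suml; apply: eq_bigr => j _.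
    by rewrite exprMn RCX; ring.
  rewrite (@eq_cmean _ _ (fun t => theta (expi t) * (cauchy_ker z t * f (expi t))));
    last first.
    by move=> t _; exact: mulrCA.
  suff h2 : (fun k =>
    cmean (fun t =>
      theta ((radius R k)%:C * expi t) * (cauchy_ker z t * f (expi t)))) @ \oo -->
        theta z * f z.
    exact: cvg_unique h2 h1.
  have hv : (fun k => theta ((radius R k)%:C * z)) @ \oo --> theta z.
    apply: (H2_cvg ht dz); last exact: (cvg_comp _ _ (@radius_left R) (@cvg_rC z)).
    apply: nearW => k; apply/discE; have /andP[r0 r1] := radius01 R k.
    rewrite cabsM cabsR ger0_norm//; apply: le_lt_trans z1.
    by rewrite ler_piMl ?cabs_ge0// ltW.
  rewrite (_ : (fun k => _) = fun k => theta ((radius R k)%:C * z) * f z);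
    last first.
    by apply/funext => k; exact: e.
  by apply: cvgMl; exact: hv.
- by apply: ae_circS2 (H2_radial ht) (H2_radial hf) => t _ h1 h2; exact: cvgM h1 h2.
Qed.

End Closure.

(** * Uniqueness and difference quotients *)

Section Division.
Variable R : realType.
Local Notation C := (Cx R).
Implicit Types (h : R -> R) (z lam : C) (f u theta : C -> C).

Lemma H2_unique f : H2 f -> aeT (fun z => f z = 0) -> forall z, disc z -> f z = 0.
Proof.
move=> hf f0 z dz; rewrite (H2_repr hf dz) -[RHS]cmean_cst.
have [mf _] := H2_sqint hf.
apply: eq_cmean_ae; first exact: cmeasurableM (cmeasurable_cauchy_ker _) mf.
  exact: cmeasurable_cst.
by apply: ae_circS f0 => t _ h; rewrite [f _]h mulr0.
Qed.

Lemma cvg_left_eq (p q : R -> C)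
  (l m : C) : (\forall r \near (1 : R)^'-, p r = q r) ->
  p @ (1 : R)^'- --> l -> q @ (1 : R)^'- --> m -> l = m.
Proof.
move=> pq pl qm.
have ql : q @ (1 : R)^'- --> l.
  by apply: cvg_trans pl; apply: near_eq_cvg; apply: filterS pq.
exact: cvg_unique ql qm.
Qed.

Lemma near_left_ge (s : R) : s < 1 ->
  \forall r \near (1 : R)^'-, [/\ s < r, 0 <= r & r < 1].
Proof.
move=> s1; near=> r; split.
- by near: r; exact: nbhs_left_gt.
- by near: r; apply: nbhs_left_ge.
- by near: r; exact: nbhs_left_lt.
Unshelve. all: by end_near. Qed.

Lemma H2_boundary_eq f u : H2 f -> H2 u -> (forall z, disc z -> f z = u z) ->
  aeT (fun z => f z = u z).
Proof.
move=> hf hu fu; apply: ae_circS2 (H2_radial hf) (H2_radial hu) => t _ h1 h2.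
apply: cvg_left_eq _ h1 h2.
apply: filterS (near_left_ge ltr01) => r [_ r0 r1]; apply: fu.
by apply/discE; rewrite cabs_rexpi.
Qed.

Lemma Hinf_cst (c : C) : Hinf (fun=> c).
Proof. by split; [exact: H2_cst|exists (cabs c)]. Qed.
Lemma Hinf_id : Hinf (id : C -> C).
Proof.
split; first by apply: H2_ext (H2_mulz (H2_cst 1)) => z _; rewrite mulr1.
by exists 1 => z /discE /ltW.
Qed.
Lemma HinfM theta f : Hinf theta -> Hinf f -> Hinf (fun z => theta z * f z).
Proof.
move=> ht hf; have [hf1 [M hM]] := hf; have [_ [N hN]] := ht.
split; first exact: H2_mul.
exists (N * M) => z dz; rewrite cabsM; apply: ler_pM; rewrite ?cabs_ge0//;
  [exact: hN|exact: hM].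
Qed.
Lemma HinfB theta f : Hinf theta -> Hinf f -> Hinf (fun z => theta z - f z).
Proof.
move=> [ht [M hM]] [hf [N hN]]; split; first exact: H2B.
by exists (M + N) => z dz; apply: le_trans (cabsB _ _) (lerD (hM z dz) (hN z dz)).
Qed.
Lemma HinfX theta n : Hinf theta -> Hinf (fun z => theta z ^+ n).
Proof.
move=> ht; elim: n => [|n IH].
  rewrite (_ : (fun z => _) = fun=> 1); first exact: Hinf_cst.
  by apply/funext => z; rewrite expr0.
rewrite (_ : (fun z => _) = fun z => theta z * theta z ^+ n); first exact: HinfM.
by apply/funext => z; rewrite exprS.
Qed.

Lemma expi_neq lam (t : R) : disc lam -> expi t - lam != 0 :> C.
Proof.
move=> /discE l1; rewrite subr_eq0; apply: contraTneq l1 => <-.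
by rewrite cabs_expi ltxx.
Qed.

Lemma expiB_inv lam (t : R) : disc lam ->
  (expi t - lam)^-1 = (expi t)^* * cauchy_ker lam t :> C.
Proof.
move=> dl; have n := expi_neq t dl; have /discE l1 := dl.
apply: (mulfI n); rewrite mulfV// /cauchy_ker mulrA mulrBl expiJ.
by rewrite mulfV// cauchy_ker_neq0.
Qed.

(** On the circle 1 / (e^(it) - lam) is e^(-it) times the Cauchy kernel at
    lam, so partial fractions turn the Cauchy integral of the quotient into
    the difference of two Cauchy integrals of f - f lam. At lam itself, the
    derivative and the Cauchy integral are both the limit of the quotient. *)
Lemma H2_k_tilde f lam : H2 f -> disc lam -> H2 (k_tilde f lam).
Proof.
move=> hf dl; have cf := H2_sqint hf; have l1 : cabs lam < 1 by exact/discE.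
pose q (t : R) : C := cauchy_ker lam t * ((expi t)^* * (f (expi t) - f lam)).
have kq t : k_tilde f lam (expi t) = q t.
  rewrite /k_tilde -subr_eq0 (negbTE (expi_neq t dl)) expiB_inv// /q; ring.
have cfl : sqint (fun t => f (expi t) - f lam) by exact: sqintB cf (sqint_cst _).
have cq : sqint q.
  apply: (sqint_bddM (M := (1 - cabs lam)^-1) (cmeasurable_cauchy_ker lam)).
    by apply: ae_circW => t _; exact: cauchy_ker_bound.
  apply: (sqint_bddM (M := 1) (cmeasurableJ (@cmeasurable_expi R)) _ cfl).
  by apply: ae_circW => t _; rewrite cabsJ cabs_expi.
have rq z : disc z -> z != lam ->
  (f z - f lam) / (z - lam) = cmean (fun t => cauchy_ker z t * q t).
  move=> dz zl; have z1 : cabs z < 1 by exact/discE.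
  have zl0 : z - lam != 0 by rewrite subr_eq0.
  apply: (mulIf zl0); rewrite mulfVK// mulrC -cmeanZ;
    last exact: cauchy_ker_cintegrable (sqint_cintegrable cq).
  rewrite (@eq_cmean _ _ (fun t =>
    cauchy_ker z t * (f (expi t) - f lam) - cauchy_ker lam t *
      (f (expi t) - f lam))); last first.
    move=> t _; rewrite -mulrBl cauchy_kerB// /q; ring.
  rewrite cmeanB; try exact: cauchy_ker_cintegrable (sqint_cintegrable cfl).
  have hfl := H2B hf (H2_cst (f lam)).
  by rewrite -(H2_repr hfl dz) -(H2_repr hfl dl) subrr subr0.
have dq : derive1 f lam = cmean (fun t => cauchy_ker lam t * q t).
  rewrite /derive1; apply: cvg_lim => //.
  have h0 : (fun h : C => h + lam) @ (0 : C)^' --> lam.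
    rewrite -[X in _ --> X]add0r; apply: cvgD; last exact: cvg_cst.
    exact: cvg_within.
  apply: cvg_trans (cauchy_cvg (sqint_cintegrable cq) dl h0).
  apply: near_eq_cvg.
  have hd : \forall h \near (0 : C)^', disc (h + lam).
    have s0 : 0 < 1 - cabs lam by rewrite subr_gt0.
    move/cvgCP/cvgrPdist_lt : h0 => /(_ _ s0); apply: filterS => h.
    rewrite addrK sub0r normrN ger0_norm ?cabs_ge0// => hh; apply/discE.
    by apply: le_lt_trans (cabsD _ _) _; rewrite -ltrBrDr.
  have hn : \forall h \near (0 : C)^', h != 0 by exact: nbhs_dnbhs_neq.
  apply: filterS2 hd hn => h hh h00.
  rewrite -rq//; first by rewrite addrK mulrC.
  by rewrite -subr_eq0 addrK.
apply: H2_of_repr.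
- by apply/sqint_L2T; rewrite (_ : (fun t => _) = q)//; exact/funext.
- move=> z dz; rewrite (@eq_cmean _ _ (fun t => cauchy_ker z t * q t));
    last by move=> t _; rewrite kq.
  by rewrite /k_tilde; case: eqVneq => [->|zl]; [exact: dq|exact: rq].
- apply: ae_circS (H2_radial hf) => t _ h.
  rewrite {2}/k_tilde -subr_eq0 (negbTE (expi_neq t dl)).
  have h1 : (fun r : R => (f (r%:C * expi t) - f lam) / (r%:C * expi t - lam)) @
    (1 : R)^'- -->
      (f (expi t) - f lam) / (expi t - lam).
    apply: cvgM; first exact: cvgB h (cvg_cst _).
    by apply: cvgV; [exact: expi_neq|exact: cvgB (@cvg_rC _ _) (cvg_cst _)].
  apply: cvg_trans h1; apply: near_eq_cvg.
  apply: filterS (near_left_ge l1) => r [lr r0 r1].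
  rewrite /k_tilde ifF//; apply: contraTF lr => /eqP <-.
  by rewrite cabs_rexpi// ltxx.
Qed.

End Division.

(** * Reciprocals, the Poisson kernel and the maximum principle *)

Section Modulus.
Variable R : realType.
Local Notation C := (Cx R).
Local Notation Re := (@complex.Re R).
Implicit Types (g h : R -> R) (z w lam : C) (theta : C -> C) (a c : C).

Lemma cabs_1B_gt0 a w : cabs a < 1 -> cabs w <= 1 -> 1 - cabs a <= cabs (1 - a * w).
Proof.
move=> a1 w1; apply: le_trans (cabs_1B _); rewrite lerB// cabsM.
by rewrite ler_piMr ?cabs_ge0.
Qed.

Lemma neq0_1B a w : cabs a < 1 -> cabs w <= 1 -> 1 - a * w != 0.
Proof.
move=> a1 w1; rewrite -cabs_eq0 gt_eqF//.
by apply: lt_le_trans (cabs_1B_gt0 a1 w1); rewrite subr_gt0.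
Qed.

Lemma cabs_1BV_le a w : cabs a < 1 -> cabs w <= 1 ->
  cabs (1 - a * w)^-1 <= (1 - cabs a)^-1.
Proof.
move=> a1 w1; have h := cabs_1B_gt0 a1 w1.
have h0 : 0 < 1 - cabs a by rewrite subr_gt0.
by rewrite cabsV lef_pV2// posrE (lt_le_trans h0 h).
Qed.

Lemma H2_geom theta a n : Hinf theta ->
  H2 (fun z => \sum_(0 <= k < n) (a * theta z) ^+ k).
Proof.
move=> ht; elim: n => [|n IH].
  rewrite (_ : (fun z => _) = fun=> 0); first exact: H2_cst.
  by apply/funext => z; rewrite big_nil.
rewrite (_ : (fun z => _) = fun z =>
  \sum_(0 <= k < n) (a * theta z) ^+ k + (a * theta z) ^+ n).
  apply: H2D IH _; have [] // := HinfX n (HinfM (Hinf_cst a) ht).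
by apply/funext => z; rewrite big_nat_recr.
Qed.

(** The partial sums of the geometric series belong to H^2 and converge
    uniformly, inside the disc and almost everywhere on the circle; so the
    Cauchy formula passes to the limit. *)
Lemma Hinf_recip theta a : Hinf theta ->
  (forall z, disc z -> cabs (theta z) <= 1) ->
  cabs a < 1 -> Hinf (fun z => (1 - a * theta z)^-1).
Proof.
move=> ht t1 a1; have [ht2 _] := ht; have [mt _] := H2_sqint ht2.
have bt := Hinf_ae ht2 t1.
pose g (t : R) : C := (1 - a * theta (expi t))^-1.
have mg : cmeasurable g.
  apply: cmeasurableV; apply: cmeasurableB; first exact: cmeasurable_cst.
  by apply: cmeasurableM mt; exact: cmeasurable_cst.
have bg : ae_circ (fun t => cabs (g t) <= (1 - cabs a)^-1).
  by apply: ae_circS bt => t _ h; exact: cabs_1BV_le.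
have cg : sqint g by exact: sqint_bdd mg bg.
have bnd : forall z, disc z -> cabs (1 - a * theta z)^-1 <= (1 - cabs a)^-1.
  by move=> z dz; apply: cabs_1BV_le => //; exact: t1.
split; last by exists (1 - cabs a)^-1.
apply: H2_of_repr.
- exact/sqint_L2T.
- move=> z dz; have /discE z1 := dz.
  pose p n z := \sum_(0 <= k < n) (a * theta z) ^+ k.
  have hp n : H2 (p n) by exact: H2_geom.
  have h1 : (fun n => p n z) @ \oo --> (1 - a * theta z)^-1.
    by apply: cvg_geomC; rewrite cabsM (le_lt_trans _ a1)// ler_piMr ?cabs_ge0// t1.
  suff h2 : (fun n => p n z) @ \oo --> cmean (fun t => cauchy_ker z t * g t).
    exact: cvg_unique h1 h2.
  apply/cvgCP; pose K := (1 - cabs z)^-1 * (1 - cabs a)^-1.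
  apply: (@squeeze_cvgr _ _ _ _ (cst 0) (fun n => cabs a ^+ n * K)).
  + apply: nearW => n; rewrite cabs_ge0/= (H2_repr (hp n) dz).
    have cpn := H2_sqint (hp n).
    rewrite -cmeanB; try by apply: cauchy_ker_cintegrable => //;
      exact: sqint_cintegrable.
    rewrite -[leRHS]rmean_cst; apply: cmean_le_ae.
    * by apply: cintegrableB; apply: cauchy_ker_cintegrable => //;
        exact: sqint_cintegrable.
    * exact: rintegrable_cst.
    * apply: ae_circS bt => t _ h; have n0 := neq0_1B a1 h.
      have -> : cauchy_ker z t * p n (expi t) - cauchy_ker z t * g t = -
        ((a * theta (expi t)) ^+ n * (cauchy_ker z t * g t)).
        have e : p n (expi t) = (1 - (a * theta (expi t)) ^+ n) * g t.
          apply: (mulfI n0); rewrite csum_geom /g mulrCA mulfV ?mulr1//.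
        by rewrite e; ring.
      rewrite cabsN cabsM cabsX cabsM; apply: ler_pM;
        rewrite ?exprn_ge0 ?mulr_ge0 ?cabs_ge0//.
        by rewrite lerXn2r ?nnegrE ?mulr_ge0 ?cabs_ge0// ler_piMr ?cabs_ge0.
      by rewrite cabsM; apply: ler_pM;
        rewrite ?cabs_ge0 ?cauchy_ker_bound ?cabs_1BV_le.
  + exact: cvg_cst.
  + rewrite -[X in _ --> X](mul0r K); apply: cvgMl; apply: cvg_expr.
    by rewrite ger0_norm ?cabs_ge0.
- apply: ae_circS2 bt (H2_radial ht2) => t _ b h.
  apply: cvgV; first exact: neq0_1B.
  exact: cvgB (cvg_cst _) (cvgMr h).
Qed.

Lemma Hinf_kernel lam : disc lam -> Hinf (fun z => (1 - lam^* * z)^-1).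
Proof.
move=> /discE l1; apply: (Hinf_recip (Hinf_id R)); last by rewrite cabsJ.
by move=> z /discE /ltW.
Qed.

Lemma cauchy_kerJ lam (t : R) : (1 - lam^* * expi t)^-1 = (cauchy_ker lam t)^* :> C.
Proof. by rewrite /cauchy_ker cjV cjB cj1 cjM cjK. Qed.

(** Multiplying theta by the reproducing kernel at lam makes the weight in
    the Cauchy formula positive. *)
Lemma poisson theta lam : H2 theta -> disc lam ->
  theta lam * (1 - lam^* * lam)^-1 =
  cmean (fun t => theta (expi t) * (cabs (cauchy_ker lam t) ^+ 2)%:C).
Proof.
move=> ht dl; have h := H2_mul (Hinf_kernel dl) ht.
rewrite mulrC (H2_repr h dl); apply: eq_cmean => t _.
by rewrite cauchy_kerJ -mulcJ; ring.
Qed.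

Definition poisson_mass lam : R := rmean (fun t => cabs (cauchy_ker lam t) ^+ 2).

Lemma poisson_massE lam : disc lam ->
  (1 - lam^* * lam)^-1 = (poisson_mass lam)%:C :> C.
Proof.
move=> dl; have := poisson (H2_cst 1) dl; rewrite mul1r => ->.
by rewrite /poisson_mass -cmean_real; apply: eq_cmean => t _; rewrite mul1r.
Qed.

Lemma poisson_mass_gt0 lam : disc lam -> 0 < poisson_mass lam.
Proof.
move=> dl; rewrite lt_neqAle rmean_ge0 ?andbT; last by move=> t _; exact: sqr_ge0.
have := poisson_massE dl; have /discE l1 := dl.
have : (1 - lam^* * lam) != 0 by apply: disc_neq1; rewrite cabsM cabsJ;
  apply: mulr_ilt1; rewrite ?cabs_ge0.
rewrite -invr_eq0 => + e; rewrite e; apply: contraNneq => <-.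
by apply/eqP.
Qed.

(** By [poisson], theta lam is an average of unimodular numbers. *)
Lemma unimod_le1 theta lam : H2 theta -> aeT (fun z => `|theta z| = 1) ->
  disc lam ->
  cabs (theta lam) <= 1.
Proof.
move=> ht t1 dl; have p0 := poisson_mass_gt0 dl.
rewrite -(ler_pM2r p0) mul1r.
have /discE l1 := dl; have [mt _] := H2_sqint ht; have [mk ik] :=
  cauchy_ker_sqint l1.
have -> : cabs (theta lam) * poisson_mass lam =
  cabs (theta lam * (1 - lam^* * lam)^-1).
  by rewrite poisson_massE// cabsM cabsR gtr0_norm.
rewrite poisson//; apply: cmean_le_ae => //.
  apply: (cintegrable_bddM (M := 1) mt); last exact: cintegrable_real.
  by apply: ae_circS t1 => t _ /eqP;
    rewrite cnormE (inj_eq (@complexI R)) => /eqP ->.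
apply: ae_circS t1 => t _ /eqP; rewrite cnormE (inj_eq (@complexI R)) => /eqP h.
by rewrite cabsM h mul1r cabsR ger0_norm ?sqr_ge0.
Qed.

(** An average of unimodular numbers with positive weights has modulus 1
    only if almost all of them are equal to it. *)
Lemma unimod_const theta lam : H2 theta -> aeT (fun z => `|theta z| = 1) ->
  disc lam ->
  cabs (theta lam) = 1 -> aeT (fun z => theta z = theta lam).
Proof.
move=> ht t1 dl c1; have /discE l1 := dl.
set c := theta lam; have [mt _] := H2_sqint ht; have [mk ik] := cauchy_ker_sqint l1.
have bt : ae_circ (fun t => cabs (theta (expi t)) <= 1).
  by apply: ae_circS t1 => t _ /eqP;
    rewrite cnormE (inj_eq (@complexI R)) => /eqP ->.
pose P (t : R) : C := (cabs (cauchy_ker lam t) ^+ 2)%:C.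
have iP : cintegrable P by exact: cintegrable_real.
have itP : cintegrable (fun t => theta (expi t) * P t)
  by exact: cintegrable_bddM mt bt iP.
pose E (t : R) : C := P t - c^* * (theta (expi t) * P t).
have iE : cintegrable E by apply: cintegrableB => //; exact: cintegrableZ.
have E0 : cmean E = 0.
  rewrite cmeanB//; last exact: cintegrableZ.
  rewrite cmeanZ// /P -poisson// cmean_real -/(poisson_mass lam) poisson_massE// -/c
    mulrA.
  by rewrite [c^* * c]mulrC mulcJ c1 expr1n mul1r subrr.
have ReE t : Re (E t) = (1 - Re (c^* * theta (expi t))) *
  cabs (cauchy_ker lam t) ^+ 2.
  by rewrite /E mulrA cReD cReN [Re (_ * P t)]cReM /= mulr0 subr0; ring.
have [iRE _] := iE.
have b2 : ae_circ (fun t => 0 <= Re (E t)).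
  apply: ae_circS bt => t _ h; rewrite ReE mulr_ge0 ?sqr_ge0// subr_ge0.
  apply: le_trans (ler_norm _) _; apply: le_trans (Re_le_cabs _) _.
  by rewrite cabsM cabsJ c1 mul1r.
have iN : rintegrable (fun t => `|Re (E t)|) by exact: integrable_norm iRE.
have z0 : ae_circ (fun t => `|Re (E t)| = 0).
  apply: rmean_eq0 => //.
  rewrite (@eq_rmean_ae _ _ (fun t => Re (E t))).
  - by have := congr1 Re E0; rewrite Re_cmean => ->.
  - exact: rintegrable_meas iN.
  - exact: rintegrable_meas iRE.
  - by apply: ae_circS b2 => t _; exact: ger0_norm.
have t1' : ae_circ (fun t => cabs (theta (expi t)) = 1).
  by apply: ae_circS t1 => t _ /eqP;
    rewrite cnormE (inj_eq (@complexI R)) => /eqP ->.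
apply: ae_circS2 z0 t1' => t _ /eqP + h1;
  rewrite normr_eq0 ReE mulf_eq0 sqrf_eq0 cabs_eq0.
rewrite invr_eq0 (negbTE (cauchy_ker_neq0 t l1)) orbF subr_eq0 => /eqP h.
have : cabs (theta (expi t) - c) ^+ 2 = 0.
  have r1 : cabs (theta (expi t)) ^+ 2 = 1 by rewrite h1 expr1n.
  have r2 : cabs c ^+ 2 = 1 by rewrite c1 expr1n.
  move: h r1 r2; rewrite cReM !cabs_sqr !cReD !cImD !cReN !cImN.
  case: (theta (expi t)) => x y; case: (c) => p q /= h r1 r2.
  nra.
by move=> /eqP; rewrite sqrf_eq0 cabs_eq0 subr_eq0 => /eqP.
Qed.

End Modulus.

(** * Toeplitz kernels and maximal functions *)

Section Kernels.
Variable R : realType.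
Local Notation C := (Cx R).
Local Notation Re := (@complex.Re R).
Implicit Types (F : R -> C) (z w : C) (f u theta G h : C -> C).

Lemma norm1_cabs z : `|z| = 1 -> cabs z = 1.
Proof. exact: (congr1 Re). Qed.

Definition perpH2 F := forall u, H2 u ->
  cmean (fun t => F t * (u (expi t))^*) = 0 :> C.

Lemma perpH2_ext F F' : cmeasurable F -> cmeasurable F' ->
  ae_circ (fun t => F t = F' t) -> perpH2 F -> perpH2 F'.
Proof.
move=> mF mF' FF pF u hu; have [mu' _] := H2_sqint hu; rewrite -[RHS](pF u hu);
  apply: eq_cmean_ae.
- exact: cmeasurableM mF' (cmeasurableJ mu').
- exact: cmeasurableM mF (cmeasurableJ mu').
- by apply: ae_circS FF => t _ ->.
Qed.

(** Multiplication by conj theta is adjoint to multiplication by theta,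
    which maps H^2 to itself. *)
Lemma perpH2_mulJ F theta : Hinf theta -> perpH2 F ->
  perpH2 (fun t => F t * (theta (expi t))^*).
Proof.
move=> ht pF u hu; rewrite -[RHS](pF _ (H2_mul ht hu)); apply: eq_cmean => t _.
by rewrite cjM mulrA.
Qed.

Lemma ker_toeplitzE
  (g f : C ->
    C) : ker_toeplitz g f <-> H2 f /\ perpH2 (fun t => g (expi t) * f (expi t)).
Proof.
split=> [[hf [_ hp]]|[hf hp]]; (split; first exact: hf).
  by move=> u hu; rewrite -[RHS](hp u hu); apply: eq_cmean => t _; rewrite subr0.
split; first exact: H2_cst.
by move=> u hu; rewrite -[RHS](hp u hu); apply: eq_cmean => t _; rewrite subr0.
Qed.

Lemma Linf_meas h : LinfT h -> cmeasurable (fun t => h (expi t)).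
Proof. by case. Qed.

(** F and F' = F conj w belong to the same Toeplitz kernels: apply
    [perpH2_mulJ] with w in one direction and with its inverse v in the
    other. *)
Lemma maximal_twist (G F F' w v : C -> C) : LinfT G -> maximal_function G F ->
  H2 F' ->
  Hinf w -> Hinf v -> aeT (fun z => w z * v z = 1) ->
  aeT (fun z => F' z = F z * (w z)^*) -> maximal_function G F'.
Proof.
move=> lG [/ker_toeplitzE[hF kF] [z dz Fz] maxF] hF' hw hv wv FF'.
have [hw2 _] := hw; have [mw _] := H2_sqint hw2; have [hv2 _] := hv; have [mv _] :=
  H2_sqint hv2.
have [mF _] := H2_sqint hF; have [mF' _] := H2_sqint hF'.
have FF'' : aeT (fun z => F z = F' z * (v z)^*).
  by apply: ae_circS2 wv FF' => t _ h ->; rewrite -mulrA -cjM h cj1 mulr1.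
split.
- apply/ker_toeplitzE; split; first exact: hF'.
  apply: perpH2_ext (perpH2_mulJ hw kF); last by apply: ae_circS FF' => t _ ->;
    rewrite mulrA.
    by apply: cmeasurableM (cmeasurableJ mw); apply: cmeasurableM mF;
      exact: Linf_meas.
  by apply: cmeasurableM mF'; exact: Linf_meas.
- apply: contrapT => nF'; move/eqP: Fz; apply; apply: H2_unique hF _ z dz.
  have F'0 : aeT (fun z => F' z = 0).
    apply: H2_boundary_eq hF' (H2_cst 0) _ => y dy.
    by apply/eqP; apply: contrapT => /negP ny; apply: nF'; exists y.
  by apply: ae_circS2 FF'' F'0 => t _ -> ->; rewrite mul0r.
- move=> h lh /ker_toeplitzE[_ kF']; apply: (maxF h lh); apply/ker_toeplitzE; split;
    first exact: hF.
  apply: perpH2_ext (perpH2_mulJ hv kF'); last by apply: ae_circS FF'' => t _ ->;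
    rewrite mulrA.
    by apply: cmeasurableM (cmeasurableJ mv); apply: cmeasurableM mF';
      exact: Linf_meas.
  by apply: cmeasurableM mF; exact: Linf_meas.
Qed.

(** As |B| = 1 on the circle, a function of H^2 is in the kernel of T_h
    exactly when its product with B is in the kernel of T_(h conj B). With G
    B in the role of h this relates the kernels of T_(GB) and T_G. *)
Lemma maximal_factor (G B f : C -> C) : LinfT G -> Hinf B ->
  aeT (fun z => `|B z| = 1) -> H2 f ->
  maximal_function G (fun z => B z * f z) ->
    maximal_function (fun z => G z * B z) f.
Proof.
move=> lG hB B1 hf [/ker_toeplitzE[hF kF] [z dz Fz] maxF].
have [hB2 _] := hB; have [mB _] := H2_sqint hB2.
have BJ : aeT (fun z => (B z)^* * B z = 1).
  by apply: ae_circS B1 => t _ h; rewrite mulrC mulcJ (norm1_cabs h) expr1n.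
split.
- apply/ker_toeplitzE; split; first exact: hf.
  by move=> u hu; rewrite -[RHS](kF u hu); apply: eq_cmean => t _; rewrite mulrA.
- by exists z => //; apply: contraNneq Fz => ->; rewrite mulr0.
- move=> h lh /ker_toeplitzE[_ kh].
  pose h' z := h z * (B z)^*.
  have lh' : LinfT h'.
    have [mh [M hM]] := lh; split; first exact: cmeasurableM mh (cmeasurableJ mB).
    exists M; apply: ae_circS2 B1 hM => t _ h1 h2.
    by rewrite cabsM cabsJ (norm1_cabs h1) mulr1.
  have mh := Linf_meas lh; have mh' := Linf_meas lh'.
  have kh' f' : H2 f' -> perpH2 (fun t => h (expi t) * f' (expi t)) <->
      perpH2 (fun t => h' (expi t) * (B (expi t) * f' (expi t))).
    move=> hf'; have [mf' _] := H2_sqint hf'.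
    have m1 : cmeasurable (fun t => h (expi t) * f' (expi t))
      by exact: cmeasurableM.
    have m2 : cmeasurable (fun t => h' (expi t) * (B (expi t) * f' (expi t))).
      by apply: cmeasurableM mh' _; exact: cmeasurableM.
    have e : ae_circ (fun t =>
      h (expi t) * f' (expi t) = h' (expi t) * (B (expi t) * f' (expi t))).
      by apply: ae_circS BJ => t _ e;
        rewrite /h' -mulrA [_ * (B _ * _)]mulrA e mul1r.
    by split; [apply: (perpH2_ext m1 m2 e)|apply: (perpH2_ext m2 m1);
      apply: ae_circS e => t _ ->].
  have sub0 : ker_toeplitz h' (fun z => B z * f z).
    by apply/ker_toeplitzE; split; [exact: hF|exact/(kh' f hf)].
  have sub := maxF h' lh' sub0.
  move=> f' /ker_toeplitzE[hf' kf']; apply/ker_toeplitzE; split; first exact: hf'.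
  apply/(kh' f' hf').
  suff /sub /ker_toeplitzE[_ k] : ker_toeplitz G (fun z => B z * f' z).
    exact: k.
  apply/ker_toeplitzE; split; first exact: H2_mul.
  by move=> u hu; rewrite -[RHS](kf' u hu); apply: eq_cmean => t _; rewrite mulrA.
Qed.

End Kernels.

(** * One step of the recursion *)

Section Step.
Variable R : realType.
Local Notation C := (Cx R).
Local Notation Re := (@complex.Re R).
Implicit Types (z lam c : C) (f theta : C -> C).

(** With a = theta lam, the product blaschke lam * kquot theta lam is the
    Frostman shift (theta - a) / (1 - conj a theta). *)
Definition kquot theta lam z : C := k_tilde theta lam z / k_lam theta lam z.

Lemma model_spaceE theta f : model_space theta f <->
  H2 f /\ perpH2 (fun t => (theta (expi t))^* * f (expi t)).
Proof. exact: ker_toeplitzE. Qed.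

Lemma inner_cabs theta : inner theta -> aeT (fun z => cabs (theta z) = 1).
Proof. by case=> _; apply: ae_circS => t _; exact: norm1_cabs. Qed.

Lemma inner_le1 theta z : inner theta -> disc z -> cabs (theta z) <= 1.
Proof. by case=> -[ht _] t1 dz; exact: unimod_le1. Qed.

(** If |theta lam| = 1 then theta is constant on the circle by
    [unimod_const], so that every f in its model space is orthogonal to
    itself. *)
Lemma inner_lt1 theta n lam : inner theta -> dim_ge (model_space theta) n.+1 ->
  disc lam ->
  cabs (theta lam) < 1.
Proof.
move=> it [v [Kv indep]] dl; have [[ht _] t1] := it.
rewrite lt_neqAle (inner_le1 it dl) andbT; apply/negP => /eqP c1.
have tc := unimod_const ht t1 dl c1.
suff v0 : forall z, disc z -> \sum_(i < n.+1) (1 : C) * v i z = 0.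
  by move/eqP: (indep (fun=> 1) v0 ord0); rewrite oner_eq0.
move=> z dz; rewrite big1// => i _; rewrite mul1r.
have /model_spaceE[hv kv] := Kv i.
apply: (H2_unique hv _ dz).
have cv := H2_sqint hv; have [mv iv] := cv; have [mt _] := H2_sqint ht.
have := kv _ (H2Z (theta lam)^* hv).
rewrite (@eq_cmean_ae _ _ (fun t => v i (expi t) * (v i (expi t))^*)).
- rewrite sqint_norm// => /(congr1 Re) m0.
  have z0 : ae_circ (fun t => cabs (v i (expi t)) ^+ 2 = 0).
    apply: rmean_eq0 iv _ _ => [t _|]; first exact: sqr_ge0.
    by move: m0 => /= ->.
  by apply: ae_circS z0 => t _ /eqP; rewrite sqrf_eq0 cabs_eq0 => /eqP.
- by apply: cmeasurableM;
    [exact: cmeasurableM (cmeasurableJ mt) mv|apply: cmeasurableJ;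
      apply: cmeasurableM mv; exact: cmeasurable_cst].
- exact: cmeasurableM mv (cmeasurableJ mv).
- apply: ae_circS tc => t _ ->; rewrite cjM cjK.
  have e : (theta lam)^* * theta lam = 1 by rewrite mulrC mulcJ c1 expr1n.
  transitivity ((theta lam)^* * theta lam * (v i (expi t) * (v i (expi t))^*));
    first by ring.
  by rewrite e mul1r.
Qed.

Section Fixed.
Variables (theta : C -> C) (lam : C).
Hypotheses (it : inner theta) (dl : disc lam) (a1 : cabs (theta lam) < 1).
Let a := theta lam.
Let w z : C := 1 - a^* * theta z.

Let aJ1 : cabs a^* < 1. Proof. by rewrite cabsJ. Qed.
Let l1 : cabs lam < 1. Proof. exact/discE. Qed.

Lemma kquot_w : Hinf w.
Proof. by have [ht _] := it; apply: HinfB (Hinf_cst 1) (HinfM (Hinf_cst _) ht). Qed.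

Lemma kquot_wV : Hinf (fun z => (w z)^-1).
Proof. by have [ht _] := it; apply: Hinf_recip => // z; exact: inner_le1. Qed.

Lemma kquot_w_neq0 z : disc z -> w z != 0.
Proof. by move=> dz; apply: neq0_1B => //; exact: inner_le1. Qed.

Lemma kquot_w_ae : aeT (fun z => w z != 0).
Proof.
by apply: ae_circS (inner_cabs it) => t _ h; apply: neq0_1B => //; rewrite h.
Qed.

Lemma kden_neq0 z : cabs z <= 1 -> 1 - lam^* * z != 0.
Proof. by apply: neq0_1B; rewrite cabsJ. Qed.

Lemma kquotE z : kquot theta lam z = k_tilde theta lam z *
  ((1 - lam^* * z) * (w z)^-1).
Proof. by rewrite /kquot /k_lam invf_div. Qed.

Lemma kquot_mult : Hinf (fun z => (1 - lam^* * z) * (w z)^-1).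
Proof.
exact: HinfM (HinfB (Hinf_cst 1) (HinfM (Hinf_cst _) (Hinf_id R))) kquot_wV.
Qed.

Lemma k_tilde_expi f
  (t : R) : k_tilde f lam (expi t) = (f (expi t) - f lam) / (expi t - lam).
Proof. by rewrite /k_tilde -subr_eq0 (negbTE (expi_neq t dl)). Qed.

Lemma kquot_H2 : H2 (kquot theta lam).
Proof.
have [[ht _] _] := it.
apply: H2_ext (H2_mul kquot_mult (H2_k_tilde ht dl)) => z _.
by rewrite kquotE mulrC.
Qed.

Lemma cabs_mobius z c : cabs z = 1 -> cabs (1 - c^* * z) = cabs (z - c).
Proof.
move=> z1; have -> : 1 - c^* * z = z * (z - c)^*.
  by rewrite cjB mulrBr mulcJ z1 expr1n [z * _]mulrC.
by rewrite cabsM z1 mul1r cabsJ.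
Qed.

Lemma kquot_inner : inner (kquot theta lam).
Proof.
have u1 : aeT (fun z => cabs (kquot theta lam z) = 1).
  apply: ae_circS2 kquot_w_ae (inner_cabs it) => t _ w0 t1.
  rewrite kquotE k_tilde_expi !cabsM !cabsV !cabs_mobius ?cabs_expi//.
  have n1 : cabs (expi t - lam) != 0 by rewrite cabs_eq0 expi_neq.
  have n2 : cabs (theta (expi t) - a) != 0 by rewrite -cabs_mobius// cabs_eq0.
  by rewrite -/a mulrA mulfVK// divff.
have un : aeT (fun z => `|kquot theta lam z| = 1).
  by apply: ae_circS u1 => t _ h; rewrite cnormE h.
split=> //; split; first exact: kquot_H2.
by exists 1 => z dz; exact: unimod_le1 kquot_H2 un dz.
Qed.

Lemma blaschke_kquot_expi (t : R) : w (expi t) != 0 ->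
  blaschke lam (expi t) * kquot theta lam (expi t) * w (expi t) = theta (expi t) -
    a.
Proof.
move=> w0; rewrite kquotE k_tilde_expi /blaschke -/a.
have n1 := expi_neq t dl; have n2 := kden_neq0 (cexpi_le t).
by field; rewrite n1 w0 n2.
Qed.

(** On the circle, the product of conj (kquot theta lam) with the new
    function is (conj theta) f conj (1 / w). *)
Lemma model_space_kquot f : model_space theta f -> f lam = 0 ->
  model_space (kquot theta lam) (fun z =>
    (1 - lam^* * z) * (w z)^-1 * k_tilde f lam z).
Proof.
move=> /model_spaceE[hf kf] f0; have [[ht _] _] := it; have [mt _] := H2_sqint ht.
have hTf := H2_mul kquot_mult (H2_k_tilde hf dl).
apply/model_spaceE; split; first exact: hTf.
have [ms _] := H2_sqint kquot_H2; have [mf _] := H2_sqint hf; have [mTf _] :=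
  H2_sqint hTf.
have [hwV _] := kquot_wV; have [mwV _] := H2_sqint hwV.
apply: perpH2_ext (perpH2_mulJ kquot_wV kf).
- by apply: cmeasurableM (cmeasurableJ mwV); apply: cmeasurableM mf;
    exact: cmeasurableJ.
- by apply: cmeasurableM mTf; exact: cmeasurableJ.
apply: ae_circS2 kquot_w_ae (inner_cabs it) => t _ w0 t1.
rewrite kquotE !k_tilde_expi f0 subr0 -/a /w.
have n1 := expi_neq t dl; have n2 := kden_neq0 (cexpi_le t).
have xX : theta (expi t) * (theta (expi t))^* = 1 by rewrite mulcJ t1 expr1n.
have eE := expiJ t.
have w0' : 1 - a * (theta (expi t))^* != 0.
  by have := w0; rewrite -cj_eq0 /w cjB cj1 cjM cjK.
have n1' : (expi t)^* - lam^* != 0 :> C by rewrite -cjB cj_eq0.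
have w1 : 1 - a^* * theta (expi t) != 0 by exact: w0.
rewrite !(cjM, cjV, cjB, cj1, cjK).
(* As e^(it) and theta are unimodular, the factors of the numerators are
   multiples of those of the denominators. *)
have -> : 1 - lam * (expi t)^* = (expi t)^* * (expi t - lam)
  by rewrite mulrBr [_ * expi t]mulrC eE; ring.
have -> : 1 - lam^* * expi t = expi t * ((expi t)^* - lam^*) by rewrite mulrBr eE;
  ring.
have -> : (theta (expi t))^* - a^* = (theta (expi t))^* *
  (1 - a^* * theta (expi t)).
  by rewrite mulrBr mulr1 mulrCA [_ * theta _]mulrC xX mulr1.
transitivity
  ((theta (expi t))^* * f (expi t) *
    (expi t * (expi t)^*) / (1 - a * (theta (expi t))^*)).
  by rewrite eE mulr1.
by field; rewrite n1 n1' w1 w0'.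
Qed.

(** In the span of the v i, the functions vanishing at lam have codimension
    at most one; [model_space_kquot] carries them injectively to the next
    model space. *)
Lemma dim_kquot n : dim_ge (model_space theta) n.+1 ->
  dim_ge (model_space (kquot theta lam)) n.
Proof.
move=> [v [Kv indep]].
(* The pivot v p does not vanish at lam unless all the v i do. In that case r
   i = 0 / 0 = 0, and f i is v (lift p i) unchanged. *)
have [p hp] : exists p : 'I_n.+1, v p lam = 0 -> forall i, v i lam = 0.
  have [[p vp]|all0] := pselect (exists p, v p lam != 0).
    by exists p => v0; rewrite v0 eqxx in vp.
  exists ord0 => _ i; apply/eqP; apply: contrapT => /negP vi.
  by apply: all0; exists i.
pose r i := v (lift p i) lam / v p lam.
pose f i z := v (lift p i) z - r i * v p z.
have f0 i : f i lam = 0.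
  rewrite /f /r; have [v0|v0] := eqVneq (v p lam) 0.
    by rewrite (hp v0 (lift p i)) v0 mulr0 subr0.
  by rewrite mulfVK// subrr.
have Kf i : model_space theta (f i).
  have /model_spaceE[h1 k1] := Kv (lift p i); have /model_spaceE[h2 k2] := Kv p.
  apply/model_spaceE; split; first exact: H2B h1 (H2Z _ h2).
  have [[ht [M hM]] _] := it; have [mt _] := H2_sqint ht.
  have bt := Hinf_ae ht hM.
  have bJ : ae_circ (fun t => cabs ((theta (expi t))^*) <= M).
    by apply: ae_circS bt => t _; rewrite cabsJ.
  move=> u hu; have cu := sqintJ (H2_sqint hu).
  have c1 := sqint_bddM (cmeasurableJ mt) bJ (H2_sqint h1); have c2' :=
    sqint_bddM (cmeasurableJ mt) bJ (H2_sqint h2).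
  have i1 := sqint_cintegrableM c1 cu; have i2 := sqint_cintegrableM c2' cu.
  rewrite (@eq_cmean _ _ (fun t =>
    (theta (expi t))^* * v (lift p i) (expi t) * (u (expi t))^* -
    r i * ((theta (expi t))^* * v p (expi t) * (u (expi t))^*))); last first.
    by move=> t _; rewrite /f; ring.
  rewrite cmeanB//; last exact: cintegrableZ.
  by rewrite cmeanZ// (k1 u hu) (k2 u hu) mulr0 subr0.
exists (fun i z => (1 - lam^* * z) * (w z)^-1 * k_tilde (f i) lam z); split.
  by move=> i; exact: model_space_kquot.
move=> c c0.
pose d j := if unlift p j is Some i then c i else - \sum_(i < n) c i * r i.
suff d0 : forall z, disc z -> \sum_(j < n.+1) d j * v j z = 0.
  by move=> i; have := indep d d0 (lift p i); rewrite /d liftK.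
move=> z dz; rewrite (bigD1_ord p)//= {1}/d unlift_none mulNr mulr_suml.
rewrite -sumrN -big_split/=.
rewrite (eq_bigr (fun i => c i * f i z)); last first.
  by move=> i _; rewrite /d liftK /f; ring.
have [->|zl] := eqVneq z lam.
  by rewrite big1// => i _; rewrite f0 mulr0.
have n1 : 1 - lam^* * z != 0 by apply: kden_neq0; apply: ltW; exact/discE.
have k0 : (1 - lam^* * z) * (w z)^-1 / (z - lam) != 0.
  apply: mulf_neq0; last by rewrite invr_eq0 subr_eq0.
  by apply: mulf_neq0; [exact: n1|rewrite invr_eq0; exact: kquot_w_neq0].
apply: (mulfI k0); rewrite mulr0 -[RHS](c0 z dz) mulr_sumr.
apply: eq_bigr => i _; rewrite /k_tilde (negbTE zl) f0 subr0; ring.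
Qed.

End Fixed.
End Step.

(** * The recursion *)

Section Chain.
Variable R : realType.
Local Notation C := (Cx R).
Implicit Types (z w lam : C) (G h : C -> C).

Lemma blaschke_Hinf lam : disc lam -> Hinf (blaschke lam).
Proof.
by move=> dl; exact: HinfM (HinfB (Hinf_id R) (Hinf_cst lam)) (Hinf_kernel dl).
Qed.

Lemma blaschke_expi lam (t : R) : disc lam -> cabs (blaschke lam (expi t)) = 1.
Proof.
move=> dl; rewrite /blaschke cabsM cabsV cabs_mobius ?cabs_expi// divff//.
by rewrite cabs_eq0 expi_neq.
Qed.

Definition bprod (lam : nat -> C) n z : C :=
  \prod_(1 <= j < n.+1) blaschke (lam j) z.

Lemma bprodS
  (lam : nat -> C) n z : bprod lam n.+1 z = bprod lam n z * blaschke (lam n.+1) z.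
Proof. by rewrite /bprod big_nat_recr. Qed.

Lemma bprod0 (lam : nat -> C) z : bprod lam 0 z = 1.
Proof. by rewrite /bprod big_geq. Qed.

Lemma bprod_Hinf (lam : nat -> C) n : (forall j, (1 <= j <= n)%N -> disc (lam j)) ->
  Hinf (bprod lam n) /\ forall t : R, cabs (bprod lam n (expi t)) = 1.
Proof.
elim: n => [|n IH] dl.
  split; last by move=> t; rewrite bprod0 cabs1.
  by rewrite (_ : bprod lam 0 = fun=> 1);
    [exact: Hinf_cst|apply/funext => z; exact: bprod0].
have [h1 h2] : Hinf (bprod lam n) /\ forall t : R, cabs (bprod lam n (expi t)) = 1.
  by apply: IH => j /andP[j1 jn]; apply: dl; rewrite j1 ltnW.
have dn : disc (lam n.+1) by apply: dl; rewrite /= leqnn.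
split; last by move=> t; rewrite bprodS cabsM h2 blaschke_expi// mulr1.
rewrite (_ : bprod lam n.+1 = fun z => bprod lam n z * blaschke (lam n.+1) z).
  exact: HinfM h1 (blaschke_Hinf dn).
by apply/funext => z; exact: bprodS.
Qed.

Lemma outer_step_E lam (I O : C -> C) z : disc lam -> cabs z <= 1 ->
  k_lam I lam z * (1 - lam^* * z) * O z = (1 - (I lam)^* * I z) * O z.
Proof. by move=> dl z1; rewrite /k_lam mulfVK// kden_neq0. Qed.

(** Let I be the n-th inner factor and a its value at lam n.+1. On the
    circle, conj I = 1 / I shows that the next function is the current one
    times conj (1 - conj a I). For n < N the model space of I is nonzero,
    whence |a| < 1, and this factor is the conjugate of an invertible
    element of H^oo. *)
Lemma recursion_maximal (G F I0 O0 : C -> C) (lam : nat -> C) N :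
  LinfT G -> (forall j, (1 <= j <= N)%N -> disc (lam j)) -> maximal_function G F ->
  inner I0 -> H2 O0 -> (forall z, disc z -> F z = I0 z * O0 z) ->
  dim_ge (model_space I0) N -> forall n, (n <= N)%N ->
  [/\ inner (innern I0 lam n), H2 (outern I0 O0 lam n),
      dim_ge (model_space (innern I0 lam n)) (N - n) &
      maximal_function G (fun z =>
        bprod lam n z * (innern I0 lam n z * outern I0 O0 lam n z))].
Proof.
move=> lG dl mF iI hO FE dimI; elim => [_|n IH nN].
  rewrite subn0 /=; split; [exact: iI|exact: hO|exact: dimI|].
  have [hI _] := iI; have hIO := H2_mul hI hO.
  have [/ker_toeplitzE[hF _] _ _] := mF.
  apply: (maximal_twist lG mF _ (Hinf_cst 1) (Hinf_cst 1)).
  - by apply: H2_ext hIO => z _; rewrite bprod0 mul1r.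
  - by apply: ae_circW => t _; rewrite mulr1.
  - apply: ae_circS (H2_boundary_eq hF hIO FE) => t _ ->.
    by rewrite bprod0 mul1r cj1 mulr1.
have [iIn hOn dimn mn] := IH (ltnW nN).
set th := innern I0 lam n in iIn dimn mn *; set Om :=
  outern I0 O0 lam n in hOn mn *.
have dlam : disc (lam n.+1) by apply: dl; rewrite /= nN.
have dimn' : dim_ge (model_space th) (N - n.+1).+1 by rewrite subnSK.
have a1 := inner_lt1 iIn dimn' dlam.
have hw := kquot_w (lam n.+1) iIn; have hwV := kquot_wV iIn a1.
have iI' := kquot_inner iIn dlam a1; have [hI' _] := iI'.
pose Om' z := (1 - (th (lam n.+1))^* * th z) * Om z.
have hOm' : H2 Om' by exact: H2_mul.
have eO z : cabs z <= 1 -> outern I0 O0 lam n.+1 z = Om' z by move=> z1;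
  exact: outer_step_E.
split.
- exact: iI'.
- by apply: H2_ext hOm' => z z1; rewrite eO.
- exact: dim_kquot.
have [hB B1] : Hinf (bprod lam n.+1) /\ forall t : R,
  cabs (bprod lam n.+1 (expi t)) = 1.
  by apply: bprod_Hinf => j /andP[j1 jn]; apply: dl; rewrite j1 (leq_trans jn).
apply: (maximal_twist lG mn _ hw hwV).
- by apply: H2_ext (H2_mul hB (H2_mul hI' hOm')) => z z1; rewrite eO.
- by apply: ae_circS (kquot_w_ae iIn a1) => t _ w0; rewrite mulfV.
- apply: ae_circS2 (kquot_w_ae iIn a1) (inner_cabs iIn) => t _ w0 t1.
  rewrite eO ?cexpi_le// bprodS.
  rewrite -[innern I0 lam n.+1 (expi t)]/(kquot th (lam n.+1) (expi t)) /Om'.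
  have h := blaschke_kquot_expi dlam w0.
  have xX : th (expi t) * (th (expi t))^* = 1 by rewrite mulcJ t1 expr1n.
  rewrite cjB cj1 cjM cjK.
  set s := kquot th _ _ in h *; set b := blaschke _ _ in h *.
  transitivity
    (bprod lam n (expi t) * (b * s * (1 - (th (lam n.+1))^* * th (expi t))) *
      Om (expi t)); first by ring.
  rewrite h.
  transitivity
    (bprod lam n (expi t) *
      (th (expi t) - th (lam n.+1) * (th (expi t) * (th (expi t))^*)) *
        Om (expi t)).
    by rewrite xX mulr1.
  by ring.
Qed.

End Chain.

Theorem theorem3p9 (R : realType) (G : Cx R -> Cx R) (N : nat)
    (lam : nat -> Cx R) (F I0 O0 : Cx R -> Cx R) :
  let B := fun z : Cx R => \prod_(1 <= j < N.+1) blaschke (lam j) z in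
  LinfT G ->
  ~ aeT (fun z => G z = 0) ->
  (1 <= N)%N ->
  dim_ge (ker_toeplitz G) N.+1 ->
  (forall j : nat, (1 <= j <= N)%N -> disc (lam j)) ->
  maximal_function G F ->
  inner I0 ->
  outer O0 ->
  (forall z, disc z -> F z = I0 z * O0 z) ->
  dim_ge (model_space I0) N ->
  maximal_function G (fun z => B z * innern I0 lam N z * outern I0 O0 lam N z) /\
  maximal_function (fun z => G z * B z)
    (fun z => innern I0 lam N z * outern I0 O0 lam N z).
Proof.
move=> B lG _ _ _ dl mF iI [hO _] FE dimI.
have [iN hON _ mN] := recursion_maximal lG dl mF iI hO FE dimI (leqnn N).
have [hB B1] := bprod_Hinf dl.
split.
  rewrite (_ : (fun z => _) = fun z =>
    bprod lam N z * (innern I0 lam N z * outern I0 O0 lam N z)) //.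
  by apply/funext => z; rewrite mulrA.
have [hI _] := iN.
apply: (maximal_factor lG hB _ (H2_mul hI hON) mN).
by apply: ae_circW => t _; rewrite cnormE B1.
Qed.
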